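(* Let $\beta\in(1/\sqrt2,1)$ and $0<z<\sqrt{2\beta^2-1}$ (note $\sqrt{2\beta^2-1}<\beta$). For $d$, let $s=(1+\beta)d^{-1}\log d$ and let $K(z)$ denote the set of integers between $\frac{(1-z)n\log d}{d}$ and $\frac{(1+z)n\log d}{d}$. Then for all large enough $d$, $$\lim_{n\to\infty}\mathbb{P}\Big(\bigcup_{k\in K(z)}\mathcal{O}(n,d,\lfloor sn\rfloor,k)\ne\emptyset\Big)=0,$$ and (for integer $d$) $$\lim_{n\to\infty}\mathbb{P}\Big(\bigcup_{k\in K(z)}\mathcal{O}_d(n,\lfloor sn\rfloor,k)\ne\emptyset\Big)=0.$$
   Context: $\log$ is the natural logarithm. An independent set of a graph is a set of vertices no two of which are adjacent. For real $d>0$, $\mathbb{G}(n,d/n)$ is the Erdős–Rényi random graph on $[n]=\{1,\dots,n\}$ in which each of the $\binom n2$ possible edges is present independently with probability $d/n$. For a positive integer $d$ and $n$ with $nd$ even, $\mathbb{G}_d(n)$ is a uniformly random $d$-regular simple graph on $[n]$; limits in $n$ concerning $\mathbb{G}_d(n)$ are along $n$ with $nd$ even. For integers $0\le k\le m$, $\mathcal{O}(n,d,m,k)$ is the (random) set of pairs $(I,J)$ of independent sets of $\mathbb{G}(n,d/n)$ with $|I|=|J|=m$ and $|I\cap J|=k$; $\mathcal{O}_d(n,m,k)$ is the set of pairs $(I,J)$ of independent sets of $\mathbb{G}_d(n)$ with $|I|=|J|=m$ and $|I\cap J|=k$. *)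

(* Defs.v *)
From mathcomp Require Import all_boot all_order all_algebra.
From mathcomp Require Import all_classical all_reals all_analysis.

Set Implicit Arguments.
Unset Strict Implicit.
Unset Printing Implicit Defensive.

Import Order.TTheory GRing.Theory Num.Theory.
Import numFieldNormedType.Exports.

Local Open Scope ring_scope.

Definition vpairs (n : nat) : {set {set 'I_n}} := [set e : {set 'I_n} | #|e| == 2%N].

(* A simple graph on n vertices is its edge set, an element of [graphs n]. *)
Definition graphs (n : nat) : {set {set {set 'I_n}}} := powerset (vpairs n).

(* For G in [graphs n], the case x = y is harmless: [set x; x] is not an edge. *)
Definition independent (n : nat) (G : {set {set 'I_n}}) (I : {set 'I_n}) : bool :=
  [forall x in I, forall y in I, [set x; y] \notin G].

Definition degree (n : nat) (G : {set {set 'I_n}}) (v : 'I_n) : nat :=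
  #|[set e in G | v \in e]|.

Definition regular_graphs (n d : nat) : {set {set {set 'I_n}}} :=
  [set G in graphs n | [forall v, degree G v == d]].

(* Probability of the event A under G(n, p). It is a genuine probability for
   0 <= p <= 1; with p = d / n this holds as soon as n >= d > 0. *)
Definition gnp_prob (R : realType) (n : nat) (p : R)
    (A : pred {set {set 'I_n}}) : R :=
  \sum_(G in graphs n | A G)
    \prod_(e in vpairs n) (if e \in G then p else 1 - p).

(* Probability of the event A for the uniform d-regular graph on n vertices;
   it takes the value 0 when there is no such graph. *)
Definition regular_prob (R : realType) (n d : nat)
    (A : pred {set {set 'I_n}}) : R :=
  #|[set G in regular_graphs n d | A G]|%:R / #|regular_graphs n d|%:R.

Definition indep_pairs (n : nat) (G : {set {set 'I_n}}) (m k : nat) :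
    {set {set 'I_n} * {set 'I_n}} :=
  [set IJ : {set 'I_n} * {set 'I_n} |
    [&& independent G IJ.1, independent G IJ.2,
        #|IJ.1| == m, #|IJ.2| == m & #|IJ.1 :&: IJ.2| == k]].

Definition inK (R : realType) (n : nat) (d z : R) (k : nat) : bool :=
  (1 - z) * n%:R * ln d / d <= k%:R <= (1 + z) * n%:R * ln d / d.

(* floor (s n) with s = (1 + beta) log d / d; [Num.truncn] is the floor on
   nonnegative reals, so this is the floor as soon as d >= 1 and beta >= -1. *)
Definition indep_size (R : realType) (n : nat) (d beta : R) : nat :=
  Num.truncn ((1 + beta) * d^-1 * ln d * n%:R).

(* The union runs over k <= m only; a larger k gives an empty set of pairs. *)
Definition overlap_event (R : realType) (n : nat) (d beta z : R) :
    pred {set {set 'I_n}} :=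
  fun G => let m := indep_size n d beta in
    \bigcup_(k < m.+1 | inK n d z k) indep_pairs G m k != finset.set0.

(* Main.v *)
(** The proof is a first-moment bound. With N = n log d / d, m = (1 + beta) N and k = x N, there are
    at most d^(2m - k) pairs of m-sets meeting in k vertices, and each pair is independent with
    probability about exp(-(d/n)(m^2 - k^2/2)); the exponents add up to
    (n log^2 d / d) (1/2 - beta^2 + (x - 1)^2/2), which is negative for |x - 1| <= z.
    For G(n, d/n) the probability is exact: it is (1 - d/n) to the number of forbidden edges.
    For regular graphs it follows from switchings, with no enumeration of regular graphs.
    First, the number of edges between I \ J and J \ I is below a small multiple of m d, up to
    probability exp(-c n log d), which beats the number of pairs. Second, among such graphs let
    N_j be the number of those with j edges inside I or J; switchings give
    N_j / N_(j+1) <= (j + 1) / mu with mu close to (d/n)(m^2 - k^2/2), as long as j <= mu, hence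
    N_0 <= N_mu mu! / mu^mu, which is about exp(-mu) times the number of regular graphs. *)
Require Import Defs.
From mathcomp Require Import all_boot all_order all_algebra.
From mathcomp Require Import zify ring lra.

Set Implicit Arguments.
Unset Strict Implicit.
Unset Printing Implicit Defensive.

(** * Switchings in regular graphs *)

Lemma set2_eq (T : finType) (a b c d : T) :
  ([set a; b] == [set c; d]) =
  (a == c) && (b == d) || (a == d) && (b == c).
Proof.
apply/idP/idP; last first.
  by case/orP=> /andP[/eqP-> /eqP->]; rewrite // setUC.
move=> /eqP/setP H.
have := H a; have := H b; have := H c; have := H d.
rewrite !inE !eqxx !orbT /= !(eq_sym c) !(eq_sym d).
by case: (a == c); case: (a == d); case: (b == c); case: (b == d).
Qed.

(** * Counting by fibers and double counting *)

Lemma card_fibers (T U : finType) (S : {set T}) (P : {set U}) (f : T -> U) :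
  (forall s, s \in S -> f s \in P) ->
  #|S| = \sum_(a in P) #|[set s in S | f s == a]|.
Proof.
move=> fP; rewrite -sum1_card (partition_big f (mem P)) //=.
by apply: eq_bigr => a _; rewrite -sum1_card; apply: eq_bigl => s; rewrite inE.
Qed.

Lemma card_fibers_le (T U : finType) (S : {set T}) (P : {set U}) (f : T -> U) c :
  (forall s, s \in S -> f s \in P) ->
  (forall a, a \in P -> #|[set s in S | f s == a]| <= c) -> #|S| <= #|P| * c.
Proof.
by move=> fP fc; rewrite (card_fibers fP) -sum_nat_const; apply: leq_sum.
Qed.

Lemma card_fibers_ge (T U : finType) (S : {set T}) (P : {set U}) (f : T -> U) c :
  (forall s, s \in S -> f s \in P) ->
  (forall a, a \in P -> c <= #|[set s in S | f s == a]|) -> #|P| * c <= #|S|.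
Proof.
by move=> fP fc; rewrite (card_fibers fP) -sum_nat_const; apply: leq_sum.
Qed.

Lemma card_inj_le (T U : finType) (S : {set T}) (P : {set U}) (f : T -> U) :
  {in S &, injective f} -> (forall s, s \in S -> f s \in P) -> #|S| <= #|P|.
Proof.
move=> fI fP; rewrite -(card_in_imset fI); apply: subset_leq_card.
by apply/subsetP => _ /imsetP[s sS ->]; exact: fP.
Qed.

(** This is the form in which every switching is used: [q] labels both a move from [G] and the
    reverse move from [f G q]. As [g] undoes the move, (G, q) maps injectively to (f G q, q), and
    both sides count labelled moves. *)
Lemma double_count (T U : finType) (S S' : {set T}) (Q Q' : T -> {set U})
    (f g : T -> U -> T) lo hi :
  (forall G, G \in S -> lo <= #|Q G|) -> (forall G, G \in S' -> #|Q' G| <= hi) ->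
  (forall G q, G \in S -> q \in Q G ->
    [/\ f G q \in S', q \in Q' (f G q) & g (f G q) q = G]) ->
  #|S| * lo <= #|S'| * hi.
Proof.
move=> loQ hiQ' fP.
pose E := [set x : T * U | (x.1 \in S) && (x.2 \in Q x.1)].
pose E' := [set x : T * U | (x.1 \in S') && (x.2 \in Q' x.1)].
have EE' : #|E| <= #|E'|.
  apply: (@card_inj_le _ _ _ _ (fun x => (f x.1 x.2, x.2))).
    move=> [G q] [G' q']; rewrite !inE /= => /andP[GS Gq] /andP[G'S Gq'] [e1 e2].
    have [_ _ <-] := fP _ _ GS Gq; have [_ _ <-] := fP _ _ G'S Gq'.
    by rewrite e1 e2.
  move=> [G q]; rewrite !inE /= => /andP[GS Gq].
  by have [-> ->] := fP _ _ GS Gq.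
have fiberE (A : {set T}) (B : T -> {set U}) G : G \in A ->
    #|[set x in [set x : T * U | (x.1 \in A) && (x.2 \in B x.1)] | x.1 == G]| = #|B G|.
  move=> GA; rewrite -(card_imset (mem (B G)) (f := fun q => (G, q))); last by move=> ? ? [].
  congr #|pred_of_set _|; apply/setP => -[G' q]; rewrite !inE /=.
  apply/idP/imsetP.
    by move=> /andP[/andP[_ h] /eqP e]; exists q; rewrite -e.
  by move=> [q' q'B [-> ->]]; rewrite GA eqxx andbT.
apply: (leq_trans _ (leq_trans EE' _)).
- apply: (@card_fibers_ge _ _ _ _ fst) => [x|G GS]; first by rewrite inE => /andP[].
  by rewrite fiberE ?loQ.
- apply: (@card_fibers_le _ _ _ _ fst) => [x|G GS]; first by rewrite inE => /andP[].
  by rewrite fiberE ?hiQ'.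
Qed.

(** Ordered pairs make degree sums exact: an edge with both ends in S and in T counts twice. *)
Definition arcs n (G : {set {set 'I_n}}) (S T : {set 'I_n}) : {set 'I_n * 'I_n} :=
  [set p | [&& p.1 \in S, p.2 \in T & [set p.1; p.2] \in G]].

Definition nbrs n (G : {set {set 'I_n}}) (u : 'I_n) : {set 'I_n} :=
  [set v | [set u; v] \in G].

(** Trades ux, vy for uv, xy. *)
Definition switch n (G : {set {set 'I_n}}) (u v x y : 'I_n) : {set {set 'I_n}} :=
  [set [set u; v]; [set x; y]] :|: (G :\: [set [set u; x]; [set v; y]]).

Lemma card_arcs_sym n (G : {set {set 'I_n}}) S T : #|arcs G S T| = #|arcs G T S|.
Proof.
have le S' T' : #|arcs G S' T'| <= #|arcs G T' S'|.
  apply: (@card_inj_le _ _ _ _ (fun p => (p.2, p.1))) => [[a b] [c d] _ _ [-> ->]//|[a b]].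
  by rewrite !inE /= setUC => /and3P[-> -> ->].
by apply/eqP; rewrite eqn_leq !le.
Qed.

(** * One switching in a regular graph *)

Section Regular.
Variables (n d : nat) (G : {set {set 'I_n}}).
Hypothesis regG : G \in regular_graphs n d.

Lemma edge_neq u v : [set u; v] \in G -> u != v.
Proof.
move: regG; rewrite !inE => /andP[/subsetP sG _] /sG.
by rewrite inE cards2; case: (u == v).
Qed.

Lemma card_nbrs u : #|nbrs G u| = d.
Proof.
move: regG; rewrite !inE => /andP[/subsetP sG /forallP/(_ u)/eqP <-].
rewrite /degree -(card_in_imset (D := mem (nbrs G u)) (f := fun v => [set u; v])).
  congr #|pred_of_set _|; apply/setP => e; rewrite inE.
  apply/imsetP/andP => [[v + ->]|[eG ue]].
    by rewrite inE => ->; rewrite set21.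
  have := sG _ eG; rewrite inE => /cards2P[a [b [_ eab]]].
  move: ue; rewrite eab !inE => /orP[]/eqP->.
    by exists b; rewrite // inE -eab.
  by exists a; rewrite ?inE setUC // -eab.
move=> v w _ _ /eqP; rewrite set2_eq eqxx /= => /orP[/eqP //|/andP[/eqP-> /eqP->//]].
Qed.

Lemma card_arcs_out (S : {set 'I_n}) : #|arcs G S [set: 'I_n]| = #|S| * d.
Proof.
rewrite (@card_fibers _ _ _ S fst) => [|p]; last by rewrite inE => /andP[].
rewrite -sum_nat_const; apply: eq_bigr => u uS; rewrite -(card_nbrs u).
rewrite -(card_imset (mem (nbrs G u)) (f := fun v => (u, v))); last by move=> ? ? [].
congr #|pred_of_set _|; apply/setP => -[a b]; rewrite !inE /=.
apply/andP/imsetP => [[/andP[_ h] /eqP <-]|[v + [-> ->]]].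
  by exists b; rewrite ?inE.
by rewrite inE => ->; rewrite uS eqxx.
Qed.

Lemma arcs_sub (S T S' T' : {set 'I_n}) : S \subset S' -> T \subset T' ->
  arcs G S T \subset arcs G S' T'.
Proof.
move=> /subsetP sS /subsetP sT; apply/subsetP => p.
by rewrite !inE => /and3P[/sS-> /sT-> ->].
Qed.

Lemma card_arcs_le (S T : {set 'I_n}) : #|arcs G S T| <= #|S| * d.
Proof. by rewrite -card_arcs_out subset_leq_card// arcs_sub ?subsetT. Qed.

Lemma card_arcs_le2 (S T : {set 'I_n}) : #|arcs G S T| <= #|T| * d.
Proof. by rewrite card_arcs_sym card_arcs_le. Qed.

Variables (u v x y : 'I_n).
Hypothesis (uq : uniq [:: u; v; x; y]).

Hypotheses (uxG : [set u; x] \in G) (vyG : [set v; y] \in G).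
Hypotheses (uvG : [set u; v] \notin G) (xyG : [set x; y] \notin G).

Let neqs : [/\ [/\ u != v, u != x & u != y], [/\ v != x & v != y] & x != y].
Proof.
move: uq => /=; rewrite !inE !negb_or => /and4P[/and3P[-> -> ->] /andP[-> ->] ->] _.
by split.
Qed.

(** Exchanging v and x exchanges the added pair of edges with the removed pair, so the inverse of a
    switching is again a switching. *)
Lemma switchK : switch (switch G u v x y) u x v y = G.
Proof.
apply/setP => e; rewrite !inE.
have [->|] := eqVneq e [set u; x]; first by rewrite uxG.
have [->|] := eqVneq e [set v; y]; first by rewrite vyG.
have [->|] := eqVneq e [set u; v]; first by rewrite (negbTE uvG).
have [->|] := eqVneq e [set x; y]; first by rewrite (negbTE xyG).
by [].
Qed.

Lemma switch_regular : switch G u v x y \in regular_graphs n d.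
Proof.
have [[uv ux uy] [vx vy] xy] := neqs.
move: regG; rewrite !inE => /andP[/subsetP sG /forallP dG]; apply/andP; split.
  apply/subsetP => e; rewrite 4!inE => /orP[/orP[]/eqP->|].
  - by rewrite inE cards2 uv.
  - by rewrite inE cards2 xy.
  - by rewrite inE => /andP[_ /sG].
apply/forallP => w; rewrite -(eqP (dG w)) /degree.
have -> : [set e in switch G u v x y | w \in e] =
   [set e in [set [set u; v]; [set x; y]] | w \in e] :|:
   ([set e in G | w \in e] :\: [set e in [set [set u; x]; [set v; y]] | w \in e]).
  by apply/setP => e; rewrite !inE; case: (w \in e); rewrite ?andbF ?andbT.
rewrite cardsU.
have -> : [set e in [set [set u; v]; [set x; y]] | w \in e] :&:
   ([set e in G | w \in e] :\: [set e in [set [set u; x]; [set v; y]] | w \in e]) = set0.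
  apply/setP => e; rewrite !inE.
  have [->|] := eqVneq e [set u; v]; first by rewrite (negbTE uvG) !andbF.
  have [->|//] := eqVneq e [set x; y]; first by rewrite (negbTE xyG) !andbF.
rewrite cards0 subn0.
have cE (a b : {set 'I_n}) : a != b ->
    #|[set e in [set a; b] | w \in e]| = (w \in a) + (w \in b).
  move=> ab.
  have -> : [set e in [set a; b] | w \in e] =
      (if w \in a then [set a] else set0) :|: (if w \in b then [set b] else set0).
    apply/setP => e; rewrite !inE.
    have [->|ea] := eqVneq e a.
      by case: (w \in a); case: (w \in b); rewrite !inE ?eqxx ?(negbTE ab).
    have [->|eb] := eqVneq e b.
      by case: (w \in a); case: (w \in b); rewrite !inE ?eqxx //= eq_sym (negbTE ab).
    by case: (w \in a); case: (w \in b); rewrite !inE ?(negbTE ea) ?(negbTE eb).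
  rewrite cardsU.
  have -> : #|(if w \in a then [set a] else set0) :&: (if w \in b then [set b] else set0)| = 0.
    apply/eqP; rewrite cards_eq0; apply/eqP/setP => e.
    case: (w \in a); case: (w \in b); rewrite !inE ?andbF //.
    by have [->|] := eqVneq e a; rewrite // (negbTE ab).
  by rewrite subn0; case: (w \in a); case: (w \in b); rewrite ?cards1 ?cards0.
have cD : #|[set e in G | w \in e] :\: [set e in [set [set u; x]; [set v; y]] | w \in e]|
   + #|[set e in [set [set u; x]; [set v; y]] | w \in e]| = #|[set e in G | w \in e]|.
  have sub : [set e in [set [set u; x]; [set v; y]] | w \in e] \subset [set e in G | w \in e].
    apply/subsetP => e; rewrite !inE => /andP[+ ->].
    by case/orP=> /eqP->; rewrite ?uxG ?vyG.
  by rewrite cardsDS // subnK // subset_leq_card.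
(* The removed and the added pair of edges both cover u, v, x, y exactly once, so [w] loses as many
   edges as it gains. *)
apply/eqP; rewrite -cD addnC; congr (_ + _).
rewrite !cE; last 2 first.
- by rewrite set2_eq (negbTE uv) (negbTE uy).
- by rewrite set2_eq (negbTE ux) (negbTE uy).
have c2 (a b : 'I_n) : a != b -> (w \in [set a; b]) = (w == a) + (w == b) :> nat.
  by move=> ab; rewrite !inE; have [->|] := eqVneq w a; rewrite ?(negbTE ab).
by rewrite !c2 // addnACA.
Qed.

End Regular.

(** * Edges between I \ J and J \ I *)

Section CrossArcs.
Variables (n d m : nat) (I J : {set 'I_n}).
Hypotheses (Im : #|I| = m) (Jm : #|J| = m).

Let D := ~: (I :|: J).

(* Edges between I \ J and J \ I lie inside neither set, although both ends are in I :|: J;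
   they are counted separately because switchings of [inner_switch] only use edges
   leaving I :|: J. *)
Definition cross (G : {set {set 'I_n}}) := #|arcs G (I :\: J) (J :\: I)|.

Definition inner (G : {set {set 'I_n}}) : {set {set 'I_n}} :=
  [set e in G | (e \subset I) || (e \subset J)].

(** An arc not inside [D] leaves I, leaves J, enters I or enters J; each kind has at most m d
    arcs. *)
Lemma card_outer_arcs G : G \in regular_graphs n d ->
  n * d <= #|arcs G D D| + 4 * (m * d).
Proof.
move=> regG.
have := card_arcs_out regG [set: 'I_n]; rewrite cardsT card_ord => <-.
have : #|arcs G setT setT| <= #|arcs G D D :|: (arcs G I setT :|: arcs G J setT)
    :|: (arcs G setT I :|: arcs G setT J)|.
  apply: subset_leq_card; apply/subsetP => -[a b]; rewrite !inE /= => ->.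
  by case: (a \in I); case: (a \in J); case: (b \in I); case: (b \in J).
move/leq_trans; apply.
have le4 (S1 S2 S3 S4 S5 : {set 'I_n * 'I_n}) :
    #|S1 :|: (S2 :|: S3) :|: (S4 :|: S5)| <= #|S1| + #|S2| + #|S3| + #|S4| + #|S5|.
  by rewrite !cardsU; clear; lia.
apply: (leq_trans (le4 _ _ _ _ _)).
have := card_arcs_le regG I setT; have := card_arcs_le regG J setT.
have := card_arcs_le2 regG setT I; have := card_arcs_le2 regG setT J.
by rewrite Im Jm; clear; lia.
Qed.

(* Switch a cross edge uv with an edge xy avoiding I and J: the new edges ux, vy are not cross. *)
Lemma cross_switch a :
  #|[set G in regular_graphs n d | a.+1 <= cross G]| *
    (a.+1 * (n * d - 4 * (m * d) - 2 * (d * d))) <=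
  #|[set G in regular_graphs n d | a <= cross G]| * (m * d) ^ 2.
Proof.
pose Q (G : {set {set 'I_n}}) : {set ('I_n * 'I_n) * ('I_n * 'I_n)} :=
  [set q | [&& q.1 \in arcs G (I :\: J) (J :\: I), q.2 \in arcs G D D,
    [set q.1.1; q.2.1] \notin G & [set q.1.2; q.2.2] \notin G]].
(* Seen backwards, the label is one arc leaving I \ J and one leaving J \ I, hence at most (m d)^2
   labels. *)
pose Q' (G : {set {set 'I_n}}) : {set ('I_n * 'I_n) * ('I_n * 'I_n)} :=
  [set q | ((q.1.1, q.2.1) \in arcs G (I :\: J) setT) &&
           ((q.1.2, q.2.2) \in arcs G (J :\: I) setT)].
pose f (G : {set {set 'I_n}}) (q : ('I_n * 'I_n) * ('I_n * 'I_n)) :=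
  switch G q.1.1 q.2.1 q.1.2 q.2.2.
pose g (G : {set {set 'I_n}}) (q : ('I_n * 'I_n) * ('I_n * 'I_n)) :=
  switch G q.1.1 q.1.2 q.2.1 q.2.2.
apply: (@double_count _ _ _ _ Q Q' f g).
- move=> G; rewrite inE => /andP[regG cG].
  apply: (@leq_trans (cross G * (n * d - 4 * (m * d) - 2 * (d * d)))).
    by rewrite leq_mul2r cG orbT.
  apply: (@card_fibers_ge _ _ _ _ fst) => [q|[u v] uvP].
    by rewrite inE => /and4P[].
  rewrite -(card_in_imset (D := mem [set q in Q G | q.1 == (u, v)]) (f := snd)); last first.
    by move=> [a1 b] [a2 c]; rewrite !inE /= => /andP[_ /eqP->] /andP[_ /eqP->] ->.
  (* For a fixed cross arc uv, an outer arc xy is unusable only if x is a neighbour of u or y one of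
     v, which excludes at most 2 d^2 arcs. *)
  have : #|arcs G D D| <= #|[set q.2 | q in mem [set q in Q G | q.1 == (u, v)]] :|:
      (arcs G (nbrs G u) setT :|: arcs G setT (nbrs G v))|.
    apply/subset_leq_card/subsetP => -[x y] xyD; rewrite in_setU.
    have [ux|ux] := boolP ([set u; x] \in G).
      by apply/orP; right; move: xyD; rewrite !inE /= => /and3P[_ _ ->]; rewrite ux.
    have [vy|vy] := boolP ([set v; y] \in G).
      apply/orP; right; move: xyD; rewrite !inE /= => /and3P[_ _ ->].
      by rewrite vy orbT.
    apply/orP; left; apply/imsetP; exists ((u, v), (x, y)) => //=.
    rewrite inE eqxx andbT inE; apply/and4P; split=> //.
  move=> /leq_trans/(_ (leq_card_setU _ _)) h1.
  have h2 := leq_card_setU (arcs G (nbrs G u) setT) (arcs G setT (nbrs G v)).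
  have h3 := card_arcs_le regG (nbrs G u) setT.
  have h4 := card_arcs_le2 regG setT (nbrs G v).
  have h5 := card_outer_arcs regG.
  rewrite (card_nbrs regG) in h3; rewrite (card_nbrs regG) in h4.
  rewrite 2!leq_subLR (leq_trans h5)// addnC leq_add2l addnC.
  apply: (leq_trans h1); rewrite leq_add2l (leq_trans h2)// mul2n -addnn.
  exact: leq_add.
- move=> G; rewrite inE => /andP[regG cG].
  have le (S : {set 'I_n}) : #|S| <= m -> #|arcs G S setT| <= m * d.
    by move=> h; apply: leq_trans (card_arcs_le regG S setT) _; rewrite leq_mul2r h orbT.
  have IJm : #|I :\: J| <= m by rewrite -Im subset_leq_card// subsetDl.
  have JIm : #|J :\: I| <= m by rewrite -Jm subset_leq_card// subsetDl.
  rewrite expnS expn1; apply: leq_trans (leq_mul (le _ IJm) (le _ JIm)).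
  rewrite -cardsX; apply: (@card_inj_le _ _ _ _ (fun q => ((q.1.1, q.2.1), (q.1.2, q.2.2)))).
    by move=> [[a1 a2] [a3 a4]] [[b1 b2] [b3 b4]] _ _ /= [-> -> -> ->].
  by move=> q; rewrite inE in_setX.
move=> G [[u v] [x y]]; rewrite inE => /andP[regG cG] qQ.
rewrite !inE /= in qQ; move: qQ => /and4P[/and3P[/andP[uJ uI] /andP[vI vJ] uvG]].
rewrite 2!negb_or => /and3P[/andP[xI xJ] /andP[yI yJ] xyG] uxG vyG.
have neq (S : {set 'I_n}) (w w' : 'I_n) : w \in S -> w' \notin S -> w != w'.
  by move=> wS; apply: contraNneq => <-.
have uq : uniq [:: u; x; v; y].
  rewrite /= !inE !negb_or (neq I u x) // (neq I u v) // (neq I u y) //.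
  rewrite eq_sym (neq J v x) // (edge_neq regG xyG) // (neq J v y) //.
have regf := switch_regular regG uq uvG xyG uxG vyG.
rewrite /f /g /= (switchK uvG xyG uxG vyG); split=> //; last first.
  by rewrite !inE /= !eqxx ?orbT uJ uI vI vJ.
(* With events of the form [a <= cross G] it is enough that all cross arcs of [G] other than (u, v)
   survive. *)
rewrite inE regf /= -ltnS; apply: (leq_trans cG).
rewrite /cross (cardsD1 (u, v)).
have -> : (u, v) \in arcs G (I :\: J) (J :\: I) by rewrite !inE /= uJ uI vI vJ.
rewrite add1n ltnS; apply/subset_leq_card/subsetP => -[w b].
rewrite !inE /= xpair_eqE => /andP[nwb /and3P[/andP[wJ wI] /andP[bI bJ] ->]].
rewrite wJ wI bI bJ !set2_eq (negbTE (neq I w v _ _)) // (negbTE (neq I w x _ _)) //.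
by rewrite (negbTE (neq I w y _ _)) // !orbF (negbTE nwb) /= orbT.
Qed.

End CrossArcs.

Lemma card_orientations (T : finType) (E : {set {set T}}) :
  #|[set p : T * T | [set p.1; p.2] \in E]| <= #|E| * 2.
Proof.
apply: (@card_fibers_le _ _ _ _ (fun p => [set p.1; p.2])) => [p|e eE].
  by rewrite inE.
have [->|[[a b]]] := set_0Vmem [set s in [set p : T * T | [set p.1; p.2] \in E] |
    [set s.1; s.2] == e]; first by rewrite cards0.
rewrite inE /= => /andP[_ /eqP <-].
apply: (@leq_trans #|[set (a, b); (b, a)]|); last by rewrite cards2; case: eqP.
apply/subset_leq_card/subsetP => -[c e']; rewrite inE set2_eq => /andP[_].
by rewrite !inE /= !xpair_eqE.
Qed.

(** * Edges inside I or inside J *)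

Section InnerEdges.
Variables (n d m k : nat) (I J : {set 'I_n}).
Hypotheses (Im : #|I| = m) (Jm : #|J| = m) (IJk : #|I :&: J| = k).

Let D := ~: (I :|: J).

(** Of the m d arcs leaving I, one that does not end in [D] is an oriented inner edge or a cross
    arc. Inner edges have two orientations, while a cross edge has only one that starts in I; the
    same holds for J. *)
Lemma card_boundary_arcs G : G \in regular_graphs n d ->
  m * d - 2 * #|inner I J G| - cross I J G <= minn #|arcs G I D| #|arcs G J D|.
Proof.
move=> regG.
pose O := [set p : 'I_n * 'I_n | [set p.1; p.2] \in inner I J G].
have OE : #|O| <= 2 * #|inner I J G| by rewrite mulnC card_orientations.
have bound (S : {set 'I_n}) (X : {set 'I_n * 'I_n}) : #|S| = m -> #|X| = cross I J G ->
    arcs G S setT \subset O :|: (X :|: arcs G S D) ->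
    m * d - 2 * #|inner I J G| - cross I J G <= #|arcs G S D|.
  move=> Sm Xc /subset_leq_card; rewrite (card_arcs_out regG) Sm => h.
  rewrite 2!leq_subLR (leq_trans h)// (leq_trans (leq_card_setU _ _))//.
  by rewrite leq_add// -Xc leq_card_setU.
rewrite leq_min; apply/andP; split.
- apply: (bound _ (arcs G (I :\: J) (J :\: I))) => //.
  apply/subsetP => -[a b]; rewrite !inE /= !subUset !sub1set => /andP[-> ->] /=.
  by case: (a \in J); case: (b \in I); case: (b \in J).
- apply: (bound _ (arcs G (J :\: I) (I :\: J))) => //; first exact: card_arcs_sym.
  apply/subsetP => -[a b]; rewrite !inE /= !subUset !sub1set => /andP[-> ->] /=.
  by case: (a \in I); case: (b \in I); case: (b \in J).
Qed.

(* Switch ux, vy, with u, v both in I or both in J and x, y outside both, to uv, xy. This creates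
   exactly one inner edge and no cross edge. By inclusion-exclusion there are about
   2 (m d)^2 - (k d)^2 such choices; the term n d (2 (d + 1) d) pays for those where the four
   vertices are not distinct or uv, xy is already an edge. *)
Lemma inner_switch t j V :
  V + n * d * (2 * (d.+1 * d)) + (k * d) ^ 2 <= 2 * (m * d - 2 * j - t) ^ 2 ->
  #|[set G in regular_graphs n d | (cross I J G < t) && (#|inner I J G| == j)]| * V <=
  #|[set G in regular_graphs n d | (cross I J G < t) && (#|inner I J G| == j.+1)]| *
    (j.+1 * 2 * (n * d)).
Proof.
move=> hV.
pose Q (G : {set {set 'I_n}}) : {set ('I_n * 'I_n) * ('I_n * 'I_n)} :=
  [set q | (((q.1 \in arcs G I D) && (q.2 \in arcs G I D)) ||
            ((q.1 \in arcs G J D) && (q.2 \in arcs G J D))) &&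
    [&& q.1.1 != q.2.1, q.1.2 != q.2.2,
        [set q.1.1; q.2.1] \notin G & [set q.1.2; q.2.2] \notin G]].
pose Q' (G : {set {set 'I_n}}) : {set ('I_n * 'I_n) * ('I_n * 'I_n)} :=
  [set q | ([set q.1.1; q.2.1] \in inner I J G) && ([set q.1.2; q.2.2] \in G)].
pose f (G : {set {set 'I_n}}) (q : ('I_n * 'I_n) * ('I_n * 'I_n)) :=
  switch G q.1.1 q.2.1 q.1.2 q.2.2.
pose g (G : {set {set 'I_n}}) (q : ('I_n * 'I_n) * ('I_n * 'I_n)) :=
  switch G q.1.1 q.1.2 q.2.1 q.2.2.
apply: (@double_count _ _ _ _ Q Q' f g).
- move=> G; rewrite inE => /and3P[regG cG /eqP jG].
  pose ball u := u |: nbrs G u.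
  have ball_le u : #|ball u| <= d.+1.
    by rewrite /ball cardsU1 (card_nbrs regG) -add1n leq_add2r; case: (_ \notin _).
  (* [W] holds the spoilt choices: v equal or adjacent to u, or y equal or adjacent to x. For each
     arc ux there are at most 2 (d + 1) d of them. *)
  pose W : {set ('I_n * 'I_n) * ('I_n * 'I_n)} :=
    [set q | (q.1 \in arcs G setT setT) &&
       (q.2 \in arcs G (ball q.1.1) setT :|: arcs G setT (ball q.1.2))].
  have W_le : #|W| <= n * d * (2 * (d.+1 * d)).
    have <- : #|arcs G setT setT| = n * d by rewrite (card_arcs_out regG) cardsT card_ord.
    apply: (@card_fibers_le _ _ _ _ fst) => [q|[u x] _].
      by rewrite inE => /andP[].
    apply: (@leq_trans #|arcs G (ball u) setT :|: arcs G setT (ball x)|).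
      apply: (@card_inj_le _ _ _ _ snd).
        by move=> [a1 b] [a2 c]; rewrite 2!inE => /andP[_ /eqP] /= -> /[!inE] /andP[_ /eqP] /= -> ->.
      by move=> [a b]; rewrite 2!inE => /andP[/andP[_ h] /eqP] /= e; move: h; rewrite /= e.
    rewrite (leq_trans (leq_card_setU _ _))// mul2n -addnn leq_add//.
      by rewrite (leq_trans (card_arcs_le regG _ _))// leq_mul2r ball_le orbT.
    by rewrite (leq_trans (card_arcs_le2 regG _ _))// leq_mul2r ball_le orbT.
  have subQ : setX (arcs G I D) (arcs G I D) :|: setX (arcs G J D) (arcs G J D) \subset Q G :|: W.
    apply/subsetP => -[[u x] [v y]]; rewrite in_setU !in_setX => h.
    have [qW|] := boolP ((u, x, (v, y)) \in W); first by rewrite in_setU qW orbT.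
    have [uxG vyG] : [set u; x] \in G /\ [set v; y] \in G.
      by move: h; rewrite !inE /= => /orP[]/andP[/and3P[_ _ ->] /and3P[_ _ ->]].
    rewrite inE in_setU /= ![(u, x) \in arcs _ setT _]inE ![(v, y) \in arcs _ _ _]inE /=.
    rewrite !in_setT uxG vyG !andbT /= !in_setU1 !inE /= !negb_or.
    move=> /andP[/andP[vu uvG] /andP[yx xyG]].
    apply/orP; left; rewrite [v == u]eq_sym [y == x]eq_sym in vu yx.
    by rewrite vu yx uvG xyG; move: h; rewrite !inE !negb_or => ->.
  have subI : setX (arcs G I D) (arcs G I D) :&: setX (arcs G J D) (arcs G J D)
      \subset setX (arcs G (I :&: J) D) (arcs G (I :&: J) D).
    apply/subsetP => -[[u x] [v y]]; rewrite !inE /=.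
    by move=> /andP[/andP[/and3P[-> -> ->] /and3P[-> -> ->]] /andP[/and3P[-> _ _] /and3P[-> _ _]]].
  have k_le : #|arcs G (I :&: J) D| <= k * d by rewrite -IJk card_arcs_le.
  have := card_boundary_arcs regG; rewrite jG leq_min => /andP[aI aJ].
  have le1 : m * d - 2 * j - t <= #|arcs G I D|.
    by apply: leq_trans aI; rewrite leq_sub2l// ltnW.
  have le2 : m * d - 2 * j - t <= #|arcs G J D|.
    by apply: leq_trans aJ; rewrite leq_sub2l// ltnW.
  have := cardsUI (setX (arcs G I D) (arcs G I D)) (setX (arcs G J D) (arcs G J D)).
  rewrite !cardsX => UI.
  have h1 : 2 * (m * d - 2 * j - t) ^ 2 <=
      #|arcs G I D| * #|arcs G I D| + #|arcs G J D| * #|arcs G J D|.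
    by rewrite mul2n -addnn expnS expn1 leq_add// leq_mul.
  have h2 := leq_trans (subset_leq_card subQ) (leq_card_setU _ _).
  have h3 := subset_leq_card subI; rewrite cardsX in h3.
  have h4 : #|arcs G (I :&: J) D| * #|arcs G (I :&: J) D| <= (k * d) ^ 2.
    by rewrite expnS expn1 leq_mul.
  have := leq_trans hV h1; rewrite -UI => h5.
  have h6 := leq_trans h5 (leq_add h2 (leq_trans h3 h4)).
  rewrite leq_add2r in h6.
  by rewrite -(leq_add2r (n * d * (2 * (d.+1 * d)))) (leq_trans h6)// leq_add2l.
- move=> G; rewrite inE => /and3P[regG cG /eqP jG].
  (* Seen backwards, the label is an oriented inner edge uv and an arbitrary arc xy: at most 2 (j +
     1) times n d choices. *)
  rewrite -jG; apply: (leq_trans _ (leq_mul (card_orientations _) (leqnn _))).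
  have <- : #|arcs G setT setT| = n * d by rewrite (card_arcs_out regG) cardsT card_ord.
  rewrite -cardsX; apply: (@card_inj_le _ _ _ _ (fun q => ((q.1.1, q.2.1), (q.1.2, q.2.2)))).
    by move=> [[a1 a2] [a3 a4]] [[b1 b2] [b3 b4]] _ _ /= [-> -> -> ->].
  by move=> [[a1 a2] [a3 a4]]; rewrite in_setX !in_set.
move=> G [[u x] [v y]]; rewrite inE => /and3P[regG cG /eqP jG] qQ.
rewrite in_set /= in qQ; move: qQ => /andP[q1 /and4P[uv xy uvG xyG]].
have [uIJ vIJ] : (u \in I :|: J) /\ (v \in I :|: J).
  by move: q1; rewrite !inE => /orP[]/andP[/and3P[-> _ _] /and3P[-> _ _]]; rewrite ?orbT.
have uvI : ([set u; v] \subset I) || ([set u; v] \subset J).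
  rewrite !subUset !sub1set.
  by move: q1; rewrite !inE => /orP[]/andP[/and3P[-> _ _] /and3P[-> _ _]]; rewrite ?orbT.
have [[xI xJ] [yI yJ]] : (x \notin I /\ x \notin J) /\ (y \notin I /\ y \notin J).
  by move: q1; rewrite !inE !negb_or => /orP[]/andP[/and3P[_ /andP[-> ->] _] /and3P[_ /andP[-> ->] _]].
have [uxG vyG] : [set u; x] \in G /\ [set v; y] \in G.
  by move: q1; rewrite !inE => /orP[]/andP[/and3P[_ _ ->] /and3P[_ _ ->]].
have neq (w w' : 'I_n) : w \in I :|: J -> w' \notin I -> w' \notin J -> w != w'.
  by move=> + wI wJ; apply: contraTneq => ->; rewrite in_setU negb_or wI wJ.
have uq : uniq [:: u; v; x; y].
  by rewrite /= !inE !negb_or uv xy !neq.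
have regf := switch_regular regG uq uxG vyG uvG xyG.
have fE : f G ((u, x), (v, y)) = switch G u v x y by [].
have xyI : ([set x; y] \subset I) || ([set x; y] \subset J) = false.
  by rewrite !subUset !sub1set (negbTE xI) (negbTE xJ).
have uxI : ([set u; x] \subset I) || ([set u; x] \subset J) = false.
  by rewrite !subUset !sub1set (negbTE xI) (negbTE xJ) !andbF.
have vyI : ([set v; y] \subset I) || ([set v; y] \subset J) = false.
  by rewrite !subUset !sub1set (negbTE yI) (negbTE yJ) !andbF.
have innerE : inner I J (switch G u v x y) = [set u; v] |: inner I J G.
  apply/setP => e; rewrite !inE.
  have [->|] := eqVneq e [set u; v]; first by rewrite uvI.
  have [->|] := eqVneq e [set x; y]; first by rewrite xyI !andbF.
  have [->|] := eqVneq e [set u; x]; first by rewrite uxI !andbF.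
  have [->|//] := eqVneq e [set v; y]; first by rewrite vyI !andbF.
have gE : g (switch G u v x y) ((u, x), (v, y)) = switch (switch G u v x y) u x v y by [].
rewrite fE gE (switchK uxG vyG uvG xyG); split=> //; last first.
  rewrite in_set /= innerE setU11 /=.
  by rewrite in_setU in_set2 eqxx orbT.
rewrite in_set regf /= innerE cardsU1 jG in_set (negbTE uvG) eqxx andbT.
apply: leq_ltn_trans cG; apply/subset_leq_card/subsetP => -[w b].
rewrite in_set /= => /and3P[]; rewrite 2!in_setD => /andP[wJ wI] /andP[bI bJ].
move=> wbG; rewrite in_set /= 2!in_setD wJ wI bI bJ /=.
move: wbG; rewrite in_setU in_set2 => /orP[/orP[]/eqP e|].
- by move: uvI; rewrite -e !subUset !sub1set (negbTE wJ) (negbTE bI) !andbF.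
- have : w \in [set x; y] by rewrite -e set21.
  by rewrite in_set2 => /orP[]/eqP ew; move: wI; rewrite ew ?(negbTE xI) ?(negbTE yI).
- by rewrite in_setD => /andP[].
Qed.

End InnerEdges.

(** * Iterated switchings and counts for a fixed pair of sets *)

Section PairBounds.
Variables (n d m k : nat) (I J : {set 'I_n}).
Hypotheses (Im : #|I| = m) (Jm : #|J| = m) (IJk : #|I :&: J| = k).

(** Iterates [cross_switch] from level 2 t down to level t. Stopping at t keeps at least t + 1 cross
    edges available in each of the t steps, so all steps gain the same factor. *)
Lemma cross_tail t :
  #|[set G in regular_graphs n d | 2 * t <= cross I J G]| *
    (t.+1 * (n * d - 4 * (m * d) - 2 * (d * d))) ^ t <=
  #|regular_graphs n d| * ((m * d) ^ 2) ^ t.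
Proof.
have step i : #|[set G in regular_graphs n d | t + i <= cross I J G]| *
    (t.+1 * (n * d - 4 * (m * d) - 2 * (d * d))) ^ i <=
    #|regular_graphs n d| * ((m * d) ^ 2) ^ i.
  elim: i => [|i IH].
    rewrite !expn0 !muln1; apply/subset_leq_card/subsetP => G.
    by rewrite inE => /andP[].
  have h1 : #|[set G in regular_graphs n d | t + i.+1 <= cross I J G]| *
      (t.+1 * (n * d - 4 * (m * d) - 2 * (d * d))) <=
      #|[set G in regular_graphs n d | t + i <= cross I J G]| * (m * d) ^ 2.
    rewrite addnS; apply: leq_trans (cross_switch d Im Jm (t + i)).
    by rewrite leq_mul2l leq_mul2r ltnS leq_addr !orbT.
  rewrite expnS mulnA (leq_trans (leq_mul h1 (leqnn _)))// mulnAC.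
  by rewrite (leq_trans (leq_mul IH (leqnn _)))// -mulnA -expnSr.
by rewrite mul2n -addnn; exact: step.
Qed.

(** The product of [inner_switch] over 0, ..., j - 1 inner edges. One hypothesis at j serves all
    these steps, since its right side only grows when there are fewer inner edges. *)
Lemma inner_chain t V j :
  V + n * d * (2 * (d.+1 * d)) + (k * d) ^ 2 <= 2 * (m * d - 2 * j - t) ^ 2 ->
  #|[set G in regular_graphs n d | (cross I J G < t) && (#|inner I J G| == 0)]| * V ^ j <=
  #|regular_graphs n d| * (j`! * (2 * (n * d)) ^ j).
Proof.
move=> hV.
have step i : i <= j ->
  #|[set G in regular_graphs n d | (cross I J G < t) && (#|inner I J G| == 0)]| * V ^ i <=
  #|[set G in regular_graphs n d | (cross I J G < t) && (#|inner I J G| == i)]| *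
    (i`! * (2 * (n * d)) ^ i).
  elim: i => [|i IH] ij; first by rewrite !expn0 fact0 !muln1.
  rewrite expnSr mulnA (leq_trans (leq_mul (IH (ltnW ij)) (leqnn V)))//.
  rewrite mulnAC factS expnS.
  have := @inner_switch n d m k I J Im Jm IJk t i V.
  have -> : forall a b c e f, a * (b * c * (2 * e * f)) = a * (b * 2 * e) * (c * f).
    by move=> a b c e f; rewrite -!mulnA; do 2!congr (_ * _); rewrite mulnCA; congr (_ * _); rewrite mulnCA.
  move=> h; rewrite leq_mul2r h ?orbT //.
  apply: (leq_trans hV); rewrite leq_mul2l /= leq_exp2r //.
  by rewrite leq_sub2r // leq_sub2l // leq_mul2l ltnW.
apply: leq_trans (step j (leqnn j)) _; rewrite leq_mul2r; apply/orP; right.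
by apply/subset_leq_card/subsetP => G; rewrite inE => /andP[].
Qed.

Lemma independent_inner0 G : G \in graphs n ->
  independent G I -> independent G J -> inner I J G = set0.
Proof.
rewrite inE => /subsetP sG iI iJ; apply/setP => e; rewrite !inE.
apply/negP => /andP[eG]; move: (sG _ eG); rewrite inE => /cards2P[a [b [_ eE]]].
have no (S : {set 'I_n}) : independent G S -> e \subset S -> False.
  move=> /forall_inP iS; rewrite eE subUset !sub1set => /andP[aS bS].
  by have /forall_inP/(_ b bS) := iS a aS; rewrite -eE eG.
by case/orP; apply: no.
Qed.

Lemma regular_independent_split t :
  #|[set G in regular_graphs n d | independent G I && independent G J]| <=
  #|[set G in regular_graphs n d | t <= cross I J G]| +
  #|[set G in regular_graphs n d | (cross I J G < t) && (#|inner I J G| == 0)]|.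
Proof.
apply: leq_trans (leq_card_setU _ _); apply/subset_leq_card/subsetP => G.
rewrite !in_set => /and3P[/andP[gG dG] iI iJ].
by rewrite gG dG /= (independent_inner0 _ iI iJ) ?inE // cards0 eqxx andbT leqNgt orNb.
Qed.

Definition forbidden_pairs : {set {set 'I_n}} :=
  [set e in vpairs n | (e \subset I) || (e \subset J)].

(** Inclusion-exclusion: the pairs inside both sets are those inside I ∩ J. *)
Lemma card_forbidden_pairs : #|forbidden_pairs| + 'C(k, 2) = 2 * 'C(m, 2).
Proof.
have -> : forbidden_pairs =
    [set e : {set 'I_n} | e \subset I & #|e| == 2] :|: [set e : {set 'I_n} | e \subset J & #|e| == 2].
  by apply/setP => e; rewrite !inE andb_orr !(andbC (#|e| == 2)).
have -> : 'C(k, 2) = #|[set e : {set 'I_n} | e \subset I & #|e| == 2] :&: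
    [set e : {set 'I_n} | e \subset J & #|e| == 2]|.
  rewrite -IJk -cards_draws; congr #|pred_of_set _|; apply/setP => e.
  by rewrite !inE subsetI -!andbA; do 2!case: (_ \subset _); rewrite ?andbF ?andbb.
by rewrite cardsUI !cards_draws Im Jm mul2n addnn.
Qed.

End PairBounds.

Definition pair_shapes (n m k : nat) : {set {set 'I_n} * {set 'I_n}} :=
  [set IJ : {set 'I_n} * {set 'I_n} | [&& #|IJ.1| == m, #|IJ.2| == m & #|IJ.1 :&: IJ.2| == k]].

(** I and J are recovered from I ∩ J, I \ J and J \ I; the disjointness of these three sets is
    dropped. *)
Lemma card_pair_shapes (n m k : nat) :
  #|pair_shapes n m k| <= 'C(n, k) * ('C(n, m - k) * 'C(n, m - k)).
Proof.
have dr a : #|[set A : {set 'I_n} | #|A| == a]| = 'C(n, a) by rewrite card_draws card_ord.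
rewrite -!dr -!cardsX.
apply: (@card_inj_le _ _ _ _ (fun IJ => (IJ.1 :&: IJ.2, (IJ.1 :\: IJ.2, IJ.2 :\: IJ.1)))).
  move=> [A B] [A' B'] _ _ /= [e1 e2 e3].
  by rewrite -(setID A B) e1 e2 setID -(setID B A) e3 setIC e1 setIC setID.
move=> [A B]; rewrite inE /= => /and3P[/eqP Am /eqP Bm /eqP ABk].
by rewrite !inE /= ABk !cardsD [B :&: A]setIC ABk Am Bm !eqxx.
Qed.

(** * Estimates of exponents *)

Import Order.TTheory GRing.Theory Num.Theory.
Local Open Scope ring_scope.

(* With N = n log d / d, the first-moment exponent per pair; completing squares,
   2 m N - m^2 - k N + k^2 / 2 = N^2 / 2 - (m - N)^2 + (k - N)^2 / 2. *)
Lemma exponent_le (R : realFieldType) (beta z L N m k : R) :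
  0 < L -> 0 < N -> beta < 1 -> 1 <= beta * N -> 0 < z ->
  (1 + beta) * N - 1 <= m -> (1 - z) * N <= k <= (1 + z) * N ->
  L * (2 * m - k) - L / N * (m ^+ 2 - k ^+ 2 / 2) <=
  2 * L - (2 * beta ^+ 2 - 1 - z ^+ 2) / 2 * L * N.
Proof.
move=> L0 N0 b1 bN z0 hm /andP[hk1 hk2].
(* The 1 is the rounding of m; its cross term 2 beta N <= 2 N produces the 2 L of the bound. *)
have h1 : (beta * N - 1) ^+ 2 <= (m - N) ^+ 2.
  by rewrite ler_sqr ?nnegrE; lra.
have h2 : (k - N) ^+ 2 <= (z * N) ^+ 2.
  have a1 : 0 <= z * N - (k - N) by lra.
  have a2 : 0 <= z * N + (k - N) by lra.
  by have := mulr_ge0 a1 a2; lra.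
have h3 : beta * N <= N by rewrite ger_pMl // ltW.
have LN : 0 < L / N by rewrite divr_gt0.
have -> : L * (2 * m - k) = L / N * (N * (2 * m - k)) by field; rewrite gt_eqF.
have -> : 2 * L - (2 * beta ^+ 2 - 1 - z ^+ 2) / 2 * L * N =
   L / N * (2 * N - (2 * beta ^+ 2 - 1 - z ^+ 2) / 2 * N ^+ 2).
  by field; rewrite gt_eqF.
rewrite -mulrBr ler_pM2l //.
by move: h1 h2 h3; rewrite !exprMn !expr2; lra.
Qed.

(** The hypothesis of [inner_chain] for V = 2 n d j. Divided by 2 n d, it says that j stays below mu
    = (L / N)(m^2 - k^2 / 2) by more than the error terms; the slack kappa / 2 L N pays for them. *)
Lemma switch_margin (R : realFieldType) (kappa L N d m k j t n : R) :
  0 < L -> 0 < N -> 0 < d -> n = N * d / L -> 0 <= m <= 2 * N -> 0 <= j -> 0 <= t ->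
  256 * L <= kappa * d -> t <= kappa * N * d / 32 -> d * (d + 1) <= kappa / 4 * L * N ->
  j <= L / N * (m ^+ 2 - k ^+ 2 / 2) - kappa / 2 * L * N ->
  2 * (n * d) * j + n * d * (2 * ((d + 1) * d)) + (k * d) ^+ 2 <=
  2 * (m * d - 2 * j - t) ^+ 2.
Proof.
move=> L0 N0 d0 -> /andP[m0 m2] j0 t0 hL ht hd hj.
have LN : 0 < L / N by rewrite divr_gt0.
have kap0 : 0 < kappa by rewrite -(pmulr_lgt0 _ d0) (lt_le_trans _ hL) // mulr_gt0.
have hj4 : j <= 4 * L * N.
  apply: (le_trans hj); apply: (@le_trans _ _ (L / N * (2 * N) ^+ 2)); last first.
    by rewrite le_eqVlt; apply/orP; left; apply/eqP; field; rewrite gt_eqF.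
  have e1 : L / N * (m ^+ 2 - k ^+ 2 / 2) <= L / N * (2 * N) ^+ 2.
    rewrite ler_pM2l //.
    have : m ^+ 2 <= (2 * N) ^+ 2 by rewrite ler_sqr ?nnegrE //; lra.
    by have := sqr_ge0 k; lra.
  have : 0 <= kappa / 2 * L * N by rewrite !mulr_ge0 ?invr_ge0 // ltW.
  by lra.
(* In units of kappa L N, the budget of 1/2 splits into 1/4 for degenerate choices, 1/8 for inner
   edges and 1/8 for cross edges. *)
have key : d * (d + 1) + L / N * 2 * (m / d) * (2 * j + t) <= kappa / 2 * L * N.
  have e2 : L / N * 2 * (m / d) * (2 * j + t) <=
      L / N * 2 * (2 * N / d) * (8 * L * N + kappa * N * d / 32).
    have p0 : 0 <= L / N * 2 by rewrite mulr_ge0 // ltW.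
    have p1 : 0 <= m / d by rewrite divr_ge0 // ltW.
    apply: ler_pM => //; [by rewrite mulr_ge0 | lra | | lra].
    by rewrite ler_wpM2l // ler_pM2r ?invr_gt0.
  have e3 : L / N * 2 * (2 * N / d) * (8 * L * N + kappa * N * d / 32) =
     32 * L * L * N / d + kappa / 8 * L * N.
    by field; rewrite !gt_eqF.
  have e4 : 32 * L * L * N / d <= kappa / 8 * L * N.
    rewrite ler_pdivrMr //.
    have := ler_wpM2l (ltW (mulr_gt0 L0 N0)) hL; lra.
  by lra.
have e5 : 2 * (m * d - 2 * j - t) ^+ 2 >= 2 * (m * d) ^+ 2 - 4 * (m * d) * (2 * j + t).
  have := sqr_ge0 (2 * j + t); rewrite !expr2; lra.
apply: le_trans e5.
have P : 0 < 2 * N * d ^+ 2 / L by rewrite divr_gt0 // !mulr_gt0 // exprn_gt0.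
rewrite -(subr_ge0).
have -> : 2 * (m * d) ^+ 2 - 4 * (m * d) * (2 * j + t) -
  (2 * (N * d / L * d) * j + N * d / L * d * (2 * ((d + 1) * d)) + (k * d) ^+ 2) =
  2 * N * d ^+ 2 / L * ((L / N * (m ^+ 2 - k ^+ 2 / 2) - j) -
    (d * (d + 1) + L / N * 2 * (m / d) * (2 * j + t))).
  by field; rewrite !gt_eqF.
by rewrite mulr_ge0 ?(ltW P) //; lra.
Qed.

(** Each step of [cross_tail] gains a factor E: at least n d / 2 outer arcs are usable, t is at
    least kappa N d / 64, and (m d)^2 is at most 4 N^2 d^2. The quotient is at least kappa d / (512
    L). *)
Lemma cross_margin (R : realFieldType) (E kappa L N d m t n : R) :
  0 < L -> 0 < N -> 0 < d -> 0 < E -> n = N * d / L -> 0 <= m <= 2 * N ->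
  32 * L <= d -> 8 * d <= n -> 512 * E * L <= kappa * d -> kappa * N * d / 64 <= t ->
  E * (m * d) ^+ 2 <= t * (n * d - 4 * (m * d) - 2 * (d * d)).
Proof.
move=> L0 N0 d0 E0 nE /andP[m0 m2] hd hn hL ht.
have kap0 : 0 < kappa by rewrite -(pmulr_lgt0 _ d0) (lt_le_trans _ hL) // !mulr_gt0.
have h1 : 4 * m <= n / 4.
  have : 32 * L * (N / L) <= d * (N / L) by rewrite ler_pM2r ?divr_gt0.
  have -> : 32 * L * (N / L) = 32 * N by field; rewrite gt_eqF.
  by rewrite nE; lra.
have h2 : n * d / 2 <= n * d - 4 * (m * d) - 2 * (d * d).
  have := ler_wpM2r (ltW d0) h1; have := ler_wpM2r (ltW d0) hn; lra.
have n0 : 0 < n by rewrite (lt_le_trans _ hn) // mulr_gt0.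
have T0 : 0 <= kappa * N * d / 64 by rewrite divr_ge0 // !mulr_ge0 // ltW.
have ND : 0 <= n * d / 2 by rewrite divr_ge0 // mulr_ge0 // ltW.
apply: (le_trans _ (ler_pM T0 ND ht h2)).
apply: (@le_trans _ _ (E * (2 * N * d) ^+ 2)).
  rewrite ler_pM2l // ler_sqr ?nnegrE; first by rewrite ler_pM2r.
    by rewrite mulr_ge0 // ltW.
  by rewrite !mulr_ge0 // ltW.
rewrite nE -subr_ge0.
have -> : kappa * N * d / 64 * (N * d / L * d / 2) - E * (2 * N * d) ^+ 2 =
   N ^+ 2 * d ^+ 2 / (128 * L) * (kappa * d - 512 * E * L).
  by field; rewrite gt_eqF.
by rewrite mulr_ge0 ?subr_ge0 // divr_ge0 ?mulr_ge0 // ?exprn_ge0 // ltW.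
Qed.

(* Imported only here because classical_sets shadows many lemma names of finset. *)
From mathcomp Require Import all_classical all_reals all_analysis.
Import numFieldNormedType.Exports.

(** * First-moment bounds *)

(** A union bound over k and over pairs, for an arbitrary nonnegative weight on graphs so that it
    serves both models; m + 1 bounds the number of values of k. *)
Lemma overlap_union_bound (R : realType) (n : nat) (d beta z : R)
    (w : {set {set 'I_n}} -> R) (b : nat -> R) (B : R) :
  let m := indep_size n d beta in
  (forall G, 0 <= w G) -> 0 <= B ->
  (forall (k : nat) (I J : {set 'I_n}), (k <= m)%N -> inK n d z k ->
     #|I| = m -> #|J| = m -> #|I :&: J| = k ->
     \sum_(G | independent G I && independent G J) w G <= b k) ->
  (forall k, (k <= m)%N -> inK n d z k -> #|pair_shapes n m k|%:R * b k <= B) ->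
  \sum_(G | overlap_event d beta z G) w G <= m.+1%:R * B.
Proof.
move=> m w0 B0 hb hB.
pose c (G : {set {set 'I_n}}) (k : 'I_m.+1) : R :=
  \sum_(IJ in pair_shapes n m k | independent G IJ.1 && independent G IJ.2) w G.
have c0 G k : 0 <= c G k by apply: sumr_ge0.
apply: (@le_trans _ _ (\sum_G \sum_(k < m.+1 | inK n d z k) c G k)).
  rewrite [leLHS]big_mkcond /=; apply: ler_sum => G _.
  case: ifPn => [/set0Pn[[I J]] /bigcupP[k kK]|_]; last by apply: sumr_ge0 => k _; exact: c0.
  rewrite inE /= => /and5P[iI iJ Im Jm kE].
  rewrite (bigD1 k) //= -[leLHS]addr0 lerD//; last by apply: sumr_ge0 => ? _; exact: c0.
  rewrite /c (bigD1 (I, J)) /=; last by rewrite inE /= Im Jm kE iI iJ.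
  by rewrite lerDl sumr_ge0.
rewrite exchange_big /=.
apply: (@le_trans _ _ (\sum_(k < m.+1 | inK n d z k) B)).
  apply: ler_sum => k kK; rewrite /c.
  have km : (k <= m)%N by rewrite -ltnS.
  apply: le_trans (hB k km kK).
  rewrite (exchange_big_dep (fun IJ => IJ \in pair_shapes n m k)) /=; last by move=> ? ? _ /andP[].
  rewrite mulr_natl -sumr_const; apply: ler_sum => -[I J].
  rewrite inE /= => /and3P[/eqP Im /eqP Jm /eqP kE].
  by rewrite Im Jm kE !eqxx /=; exact: (hb k I J km kK Im Jm kE).
rewrite mulr_natl (@le_trans _ _ (\sum_(k < m.+1) B))//; last by rewrite sumr_const card_ord.
by rewrite [leLHS]big_mkcond /=; apply: ler_sum => k _; case: ifP.
Qed.

(** The right side is the product of F e + H e over all e, where F weighs a present edge, set to 0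
    on forbidden pairs, and H an absent one. Expanding it gives a sum over edge sets that contains
    every term on the left. *)
Lemma gnp_independent_le (R : realType) (n : nat) (p : R) (I J : {set 'I_n}) :
  0 <= p <= 1 -> 
  \sum_(G in graphs n | independent G I && independent G J)
     \prod_(e in vpairs n) (if e \in G then p else 1 - p) <=
  (1 - p) ^+ #|forbidden_pairs I J|.
Proof.
move=> /andP[p0 p1].
pose F (e : {set 'I_n}) := if e \in vpairs n :\: forbidden_pairs I J then p else 0.
pose H (e : {set 'I_n}) := if e \in vpairs n then 1 - p else 1.
have F0 e : 0 <= F e by rewrite /F; case: ifP.
have H0 e : 0 <= H e by rewrite /H; case: ifP; rewrite ?subr_ge0.
have -> : (1 - p) ^+ #|forbidden_pairs I J| = \prod_e (F e + H e).
  rewrite -prodr_const big_mkcond /=; apply: eq_bigr => e _.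
  rewrite /F /H finset.in_setD.
  have -> : (e \in forbidden_pairs I J) =
     (e \in vpairs n) && ((e \subset I) || (e \subset J)) by rewrite inE.
  case: (e \in vpairs n) => /=; rewrite ?andbT ?andbF ?add0r //.
  by case: ifP => _; rewrite ?add0r //= addrC subrK.
rewrite bigA_distr [leRHS](bigID (mem (graphs n))) /=.
rewrite -[leLHS]addr0 lerD//; last first.
  by apply: sumr_ge0 => G _; apply: prodr_ge0 => e _; case: ifP.
rewrite [leRHS](bigID (fun G => independent G I && independent G J)) /=.
rewrite -[leLHS]addr0 lerD//; last first.
  by apply: sumr_ge0 => G _; apply: prodr_ge0 => e _; case: ifP.
apply: ler_sum => G /andP[gG /andP[iI iJ]].
rewrite big_mkcond /=; apply: ler_prod => e _; apply/andP; split.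
  by case: ifP => // _; case: ifP; rewrite ?subr_ge0.
have inn := independent_inner0 gG iI iJ.
have Gv : e \in G -> e \in vpairs n.
  by move: gG; rewrite inE => /fintype.subsetP/(_ e).
rewrite /F /H finset.in_setD.
have [eG|eG] := boolP (e \in G); last by [].
rewrite (Gv eG) andbT; suff -> : e \notin forbidden_pairs I J by [].
apply/negP; rewrite inE (Gv eG) /= => eIJ.
by have := finset.in_set0 e; rewrite -inn inE eG eIJ.
Qed.

(** From C(n, a) y^a <= (1 + y)^n <= exp(y n) at y = a / n one gets C(n, a) <= (e n / a)^a, and the
    hypothesis reads e n / a <= exp L. *)
Lemma bin_le_expR (R : realType) (n a : nat) (L : R) :
  expR 1 * n%:R <= a%:R * expR L -> 'C(n, a)%:R <= expR (L * a%:R).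
Proof.
case: a => [_|a h]; first by rewrite bin0 mulr0 expR0.
have [an|an] := leqP a.+1 n; last by rewrite bin_small ?expR_ge0.
have a0 : 0 < a.+1%:R :> R by rewrite ltr0n.
have n0 : 0 < n%:R :> R by rewrite ltr0n (leq_trans _ an).
pose y : R := a.+1%:R / n%:R.
have y0 : 0 < y by rewrite divr_gt0.
have h1 : 'C(n, a.+1)%:R * y ^+ a.+1 <= (1 + y) ^+ n.
  rewrite exprDn (bigD1 (Ordinal (n := n.+1) (m := a.+1) an)) //=.
  rewrite expr1n mul1r mulr_natl lerDl sumr_ge0 // => i _.
  by rewrite expr1n mul1r mulrn_wge0 // exprn_ge0 // ltW.
have h2 : (1 + y) ^+ n <= expR a.+1%:R.
  have -> : a.+1%:R = y * n%:R by rewrite /y divfK // gt_eqF.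
  rewrite expRM_natr; apply: lerXn2r; rewrite ?nnegrE ?expR_ge0 ?expR_ge1Dx //.
  by rewrite addr_ge0 // ltW.
have h3 : expR (a.+1%:R : R) <= expR (L * a.+1%:R) * y ^+ a.+1.
  rewrite -[X in expR X <= _]mul1r !expRM_natr -exprMn.
  apply: lerXn2r; rewrite ?nnegrE ?expR_ge0 ?mulr_ge0 ?expR_ge0 ?(ltW y0) //.
  by rewrite /y mulrA ler_pdivlMr // [expR L * _]mulrC.
by rewrite -(ler_pM2r (exprn_gt0 a.+1 y0)) (le_trans h1)// (le_trans h2).
Qed.

(** An upper Stirling bound. For j >= 1 induction gives the factor j in place of j + 1, by (1 - 1 /
    (i + 2))^(i + 2) <= 1 / e; the factor j + 1 also covers j = 0. *)
Lemma fact_le_expR (R : realType) (j : nat) :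
  j`!%:R <= expR 1 * j.+1%:R * (j ^ j)%:R * expR (- j%:R) :> R.
Proof.
have key i : (i.+1)`!%:R <= expR 1 * i.+1%:R * (i.+1 ^ i.+1)%:R * expR (- i.+1%:R) :> R.
  elim: i => [|i IH]; first by rewrite !mulr1 -expRD subrr expR0.
  have a0 : 0 < i.+1%:R :> R by rewrite ltr0n.
  have b0 : 0 < i.+2%:R :> R by rewrite ltr0n.
  have h : expR 1 * i.+1%:R ^+ i.+2 <= i.+2%:R ^+ i.+2 :> R.
    have -> : i.+1%:R = (1 - i.+2%:R^-1) * i.+2%:R :> R.
      by rewrite mulrBl mul1r mulVf ?gt_eqF // -[i.+2]addn1 natrD addrK.
    rewrite exprMn mulrA -[leRHS]mul1r ler_pM2r ?exprn_gt0 //.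
    have h0 : expR 1 * expR (- i.+2%:R^-1) ^+ i.+2 = 1 :> R.
      by rewrite -expRM_natr mulNr mulVf ?gt_eqF // -expRD subrr expR0.
    rewrite -[leRHS]h0 ler_pM2l ?expR_gt0 //; apply: lerXn2r; rewrite ?nnegrE ?expR_ge0 //.
      by rewrite subr_ge0 invf_le1 // ler1n.
    exact: expR_ge1Dx.
  rewrite factS natrM.
  apply: (le_trans (ler_wpM2l (ltW b0) IH)).
  have -> : expR (- i.+1%:R) = expR 1 * expR (- i.+2%:R) :> R.
    by rewrite -expRD; congr expR; rewrite -[i.+2]addn1 natrD; ring.
  rewrite !natrX.
  have -> : i.+2%:R * (expR 1 * i.+1%:R * i.+1%:R ^+ i.+1 * (expR 1 * expR (- i.+2%:R)))
     = (expR 1 * i.+1%:R ^+ i.+2) * (expR 1 * i.+2%:R * expR (- i.+2%:R)) :> R.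
    by rewrite [i.+1%:R ^+ i.+2]exprS; ring.
  rewrite [leRHS](_ : _ = i.+2%:R ^+ i.+2 * (expR 1 * i.+2%:R * expR (- i.+2%:R))); last by ring.
  by rewrite ler_wpM2r // !mulr_ge0 ?expR_ge0.
case: j => [|j].
  by rewrite fact0 expn0 oppr0 expR0 !mulr1 ltW // expR_gt1.
apply: (le_trans (key j)).
rewrite ler_wpM2r ?expR_ge0 // ler_wpM2r // ler_wpM2l ?expR_ge0 //.
by rewrite ler_nat.
Qed.

(** Fits [inner_chain] with V = c j and c = 2 n d: the powers of c cancel and j! / j^j remains. *)
Lemma fact_tail_le (R : realType) (x r c j : nat) : (0 < c)%N ->
  (x * (c * j) ^ j <= r * (j`! * c ^ j))%N ->
  x%:R <= r%:R * (expR 1 * j.+1%:R * expR (- j%:R)) :> R.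
Proof.
move=> c0 h.
have h1 : (x * j ^ j <= r * j`!)%N.
  have cj : (0 < c ^ j)%N by rewrite expn_gt0 c0.
  by rewrite -(leq_pmul2r cj) -mulnA -expnMn [(j * c)%N]mulnC (leq_trans h)// mulnA.
(* At j = 0 this is 0 ^ 0 = 1. *)
have jj : 0 < (j ^ j)%:R :> R.
  by rewrite ltr0n expn_gt0; case: (j).
rewrite -(ler_pM2r jj) -natrM.
have h2 : (x * j ^ j)%:R <= (r * j`!)%:R :> R by rewrite ler_nat.
apply: (le_trans h2); rewrite [leLHS]natrM -[leRHS]mulrA ler_wpM2l //.
by rewrite (le_trans (fact_le_expR R j))// mulrAC.
Qed.

Lemma geometric_tail_le (R : realType) (x r a c t : nat) : (0 < c)%N ->
  expR 1 * c%:R <= a%:R :> R -> (x * a ^ t <= r * c ^ t)%N ->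
  x%:R <= r%:R * expR (- t%:R) :> R.
Proof.
move=> c0 ca h.
have ct : 0 < c%:R ^+ t :> R by rewrite exprn_gt0 // ltr0n.
have h1 : x%:R * (expR 1 * c%:R) ^+ t <= r%:R * c%:R ^+ t :> R.
  apply: (@le_trans _ _ (x * a ^ t)%:R).
    rewrite natrM ler_wpM2l // natrX; apply: lerXn2r; rewrite ?nnegrE ?mulr_ge0 ?expR_ge0 //.
  by rewrite -natrX -natrM ler_nat.
rewrite expRN ler_pdivlMr ?expR_gt0 // -[t%:R]mul1r expRM_natr.
by move: h1; rewrite exprMn mulrA ler_pM2r.
Qed.

(** * Limits, and the two error terms of the regular model *)

Local Open Scope classical_set_scope.
Local Open Scope ring_scope.

(** Each linear factor is at most a constant times exp(c n / 4), which leaves a geometric sequence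
    of ratio exp(-c / 2). *)
Lemma cvg_poly_expR (R : realType) (a b c K : R) : 0 <= a -> 0 <= b -> 0 <= K -> 0 < c ->
  (fun n : nat => (a * n%:R + 1) * (b * n%:R + 1) * (K * expR (- (c * n%:R))))
    @ \oo --> (0 : R).
Proof.
move=> a0 b0 K0 c0.
have lin u : 0 <= u -> forall n : nat, u * n%:R + 1 <= (u * 4 / c + 1) * expR (c / 4 * n%:R).
  move=> u0 n; have := expR_ge1Dx (c / 4 * n%:R).
  have A0 : 0 <= u * 4 / c + 1 by rewrite addr_ge0 // divr_ge0 ?mulr_ge0 // ltW.
  move=> /(ler_wpM2l A0); apply: le_trans.
  rewrite mulrDr mulr1 mulrDl mul1r.
  have -> : u * 4 / c * (c / 4 * n%:R) = u * n%:R.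
    by field; rewrite gt_eqF.
  have : 0 <= u * 4 / c by rewrite divr_ge0 ?mulr_ge0 // ltW.
  have : 0 <= c / 4 * n%:R by rewrite mulr_ge0 // divr_ge0 // ltW.
  by lra.
pose q := expR (- (c / 2)).
pose C := (a * 4 / c + 1) * (b * 4 / c + 1) * K.
apply: (@squeeze_cvgr _ _ _ _ (fun n : nat => - (C * q ^+ n)) (fun n : nat => C * q ^+ n)).
- apply: nearW => n; rewrite -ler_norml !normrM.
  have p0 u : 0 <= u -> 0 <= u * n%:R + 1 by move=> u0; rewrite addr_ge0 // mulr_ge0.
  rewrite !ger0_norm ?p0 // ?expR_ge0 //.
  have -> : C * q ^+ n = ((a * 4 / c + 1) * expR (c / 4 * n%:R)) *
     ((b * 4 / c + 1) * expR (c / 4 * n%:R)) * (K * expR (- (c * n%:R))).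
    rewrite /C /q -expRM_natr.
    have -> : - (c / 2) * n%:R = c / 4 * n%:R + (c / 4 * n%:R + - (c * n%:R)) by field.
    by rewrite !expRD; ring.
  rewrite ler_wpM2r // ?mulr_ge0 ?expR_ge0 //.
  by apply: ler_pM; rewrite ?p0 ?lin.
- rewrite -oppr0; apply: cvgN; rewrite -(mulr0 C); apply: cvgZr; apply: cvg_expr.
  by rewrite ger0_norm ?expR_ge0 // expR_lt1 oppr_lt0 divr_gt0.
- rewrite -(mulr0 C); apply: cvgZr; apply: cvg_expr.
  by rewrite ger0_norm ?expR_ge0 // expR_lt1 oppr_lt0 divr_gt0.
Qed.

(** ln d = 2 ln (sqrt d) <= 2 sqrt d, and 2 C <= sqrt d once d >= (2 C)^2. *)
Lemma near_mul_ln_le (R : realType) (C : R) : 0 < C -> \forall d \near +oo, C * ln d <= d.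
Proof.
move=> C0; near=> d.
have d0 : 0 < d by near: d; apply: nbhs_pinfty_gt; exact: num_real.
have -> : ln d = 2 * ln (Num.sqrt d).
  by rewrite -{1}(sqr_sqrtr (ltW d0)) lnXn ?sqrtr_gt0 // mulr_natl.
have s0 : 0 < Num.sqrt d by rewrite sqrtr_gt0.
have h := ltW (ln_sublinear s0).
have hC : 2 * C <= Num.sqrt d.
  have C2 : 0 <= 2 * C by rewrite mulr_ge0 // ltW.
  rewrite -(ger0_norm C2) -sqrtr_sqr; apply: ler_wsqrtr.
  by near: d; apply: nbhs_pinfty_ge; exact: num_real.
rewrite -[leRHS](sqr_sqrtr (ltW d0)) expr2 mulrA [C * 2]mulrC.
have [l0|l0] := leP 0 (ln (Num.sqrt d)).
  by apply: ler_pM => //; rewrite mulr_ge0 // ltW.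
rewrite (@le_trans _ _ 0) ?mulr_ge0 ?(ltW s0) //.
by rewrite mulr_ge0_le0 ?(ltW l0) // mulr_ge0 // ltW.
Unshelve. all: by end_near. Qed.

Lemma natr_subn_ge (R : realFieldType) (a b : nat) : a%:R - b%:R <= (a - b)%:R :> R.
Proof. by rewrite lerBlDr -natrD ler_nat addnC -leq_subLR. Qed.

(** The first exponential bounds the graphs with at least 2 t cross edges, the second those with
    fewer and no inner edge. *)
Lemma regular_independent_le (R : realType) (n d m k t j : nat) (I J : {set 'I_n}) :
  #|I| = m -> #|J| = m -> #|I :&: J| = k -> (0 < n * d)%N -> (0 < m * d)%N ->
  (2 * (n * d) * j + n * d * (2 * (d.+1 * d)) + (k * d) ^ 2 <=
    2 * (m * d - 2 * j - 2 * t) ^ 2)%N ->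
  expR 1 * ((m * d) ^ 2)%:R <= (t.+1 * (n * d - 4 * (m * d) - 2 * (d * d)))%:R :> R ->
  (#|finset (fun G => (G \in regular_graphs n d) &&
     (independent G I && independent G J))|)%:R <=
  #|regular_graphs n d|%:R *
    (expR (- t%:R) + expR 1 * j.+1%:R * expR (- j%:R)) :> R.
Proof.
move=> Im Jm IJk nd0 md0 hj ht.
have split := regular_independent_split d I J (2 * t).
have c0 : (0 < (m * d) ^ 2)%N by rewrite expn_gt0 md0.
have c1 : (0 < 2 * (n * d))%N by rewrite muln_gt0.
have tail := geometric_tail_le c0 ht (cross_tail d Im Jm t).
have chain := fact_tail_le R c1 (inner_chain Im Jm IJk hj).
rewrite mulrDr; apply: le_trans (lerD tail chain).
by rewrite -natrD ler_nat.
Qed.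

Lemma card_pair_shapes_le (R : realType) (n m k : nat) (L : R) : (k <= m)%N ->
  expR 1 * n%:R <= k%:R * expR L -> expR 1 * n%:R <= (m%:R - k%:R) * expR L ->
  #|pair_shapes n m k|%:R <= expR (L * (2 * m%:R - k%:R)).
Proof.
move=> km hk hmk; rewrite -natrB // in hmk.
have h := card_pair_shapes n m k.
apply: (@le_trans _ _ ('C(n, k) * ('C(n, m - k) * 'C(n, m - k)))%N%:R).
  by rewrite ler_nat.
have -> : L * (2 * m%:R - k%:R) =
    L * k%:R + (L * (m - k)%:R + L * (m - k)%:R) by rewrite natrB //; ring.
rewrite !natrM !expRD.
by do 2?[apply: ler_pM => //]; rewrite ?mulr_ge0 // bin_le_expR.
Qed.

(** * Overlap probabilities at a fixed degree *)

Section Bounds.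
Variables (R : realType) (beta z d : R) (n : nat).
Let L := ln d.
Let N := n%:R * L / d.
Let m := indep_size n d beta.
(** The exponential rate: the first moment decays like exp(- kappa L N). *)
Let kappa := (2 * beta ^+ 2 - 1 - z ^+ 2) / 2.

Hypotheses (z0 : 0 < z) (zb : z < beta) (b1 : beta < 1) (kappa0 : 0 < kappa).
Hypotheses (d1 : 1 < d) (Lz : expR 1 <= (1 - z) * L) (Lb : 2 * expR 1 <= (beta - z) * L).
Hypotheses (dn : d <= n%:R) (Nb : 2 <= (beta - z) * N).

Let d0 : 0 < d. Proof. by apply: lt_trans d1. Qed.
Let L0 : 0 < L. Proof. exact: ln_gt0. Qed.
Let n0 : 0 < n%:R :> R. Proof. exact: lt_le_trans dn. Qed.
Let N0 : 0 < N. Proof. by rewrite /N divr_gt0 // mulr_gt0. Qed.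
Let bN : 1 <= beta * N.
Proof. by have := mulr_gt0 z0 N0; move: Nb; lra. Qed.

Let m_bounds : (1 + beta) * N - 1 <= m%:R <= (1 + beta) * N.
Proof.
have e : (1 + beta) * d^-1 * ln d * n%:R = (1 + beta) * N.
  by rewrite /N -/L; field; rewrite gt_eqF.
have p : 0 <= (1 + beta) * N by have := bN; have := N0; lra.
rewrite /m /indep_size e; have /andP[-> h] := truncn_itv p; rewrite andbT.
by rewrite lerBlDr natr1 ltW.
Qed.

Let m_le : m%:R <= 2 * N.
Proof.
have /andP[_ h] := m_bounds; apply: (le_trans h); rewrite ler_pM2r //.
by move: b1; lra.
Qed.

Let k_bounds k : inK n d z k -> (1 - z) * N <= k%:R <= (1 + z) * N.
Proof.
rewrite /inK /N -/L => /andP[h1 h2]; apply/andP; split.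
  by apply: le_trans h1; rewrite le_eqVlt; apply/orP; left; apply/eqP; field; rewrite gt_eqF.
by apply: (le_trans h2); rewrite le_eqVlt; apply/orP; left; apply/eqP; field; rewrite gt_eqF.
Qed.

Let shapes_le k : (k <= m)%N -> inK n d z k ->
  #|pair_shapes n m k|%:R <= expR (L * (2 * m%:R - k%:R)).
Proof.
move=> km /k_bounds/andP[k1 k2].
have Nd : N * d = L * n%:R by rewrite /N; field; rewrite gt_eqF.
have dE : expR L = d by rewrite /L lnK.
apply: card_pair_shapes_le => //; rewrite dE.
  apply: (@le_trans _ _ ((1 - z) * N * d)); last by rewrite ler_pM2r.
  by rewrite -mulrA Nd mulrA ler_pM2r.
(* m - k is at least (beta - z) N - 1, and by [Nb] the 1 is at most half of the main term; hence the
   2 in [Lb]. *)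
apply: (@le_trans _ _ ((beta - z) / 2 * N * d)).
  rewrite -mulrA Nd mulrA ler_pM2r //; move: Lb; lra.
rewrite ler_pM2r //; have /andP[m1 _] := m_bounds.
by move: m1 k2 Nb; lra.
Qed.

(** Of the 4 L in the exponent, 2 L comes from the rounding of m through [exponent_le], and 2 L from
    the linear term m in the number of forbidden pairs. *)
Lemma gnp_overlap_le :
  gnp_prob (d / n%:R) (@overlap_event R n d beta z) <=
  (2 * N + 1) * expR (4 * L - kappa * L * N).
Proof.
pose w (G : {set {set 'I_n}}) : R := if G \in graphs n then
  \prod_(e in vpairs n) (if e \in G then d / n%:R else 1 - d / n%:R) else 0.
have p01 : 0 <= d / n%:R <= 1.
  by rewrite divr_ge0 ?(ltW d0) // ler_pdivrMr // mul1r.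
have w0 G : 0 <= w G.
  rewrite /w; case: ifP => // _; apply: prodr_ge0 => e _.
  by case: ifP; rewrite ?subr_ge0; case/andP: p01.
have -> : gnp_prob (d / n%:R) (@overlap_event R n d beta z) =
    \sum_(G | overlap_event d beta z G) w G.
  by rewrite /gnp_prob /w -big_mkcondl; apply: eq_bigl => G; rewrite andbC.
apply: (@le_trans _ _ (m.+1%:R * expR (4 * L - kappa * L * N))); last first.
  by rewrite ler_wpM2r ?expR_ge0 // -natr1 lerD2r.
apply: (@overlap_union_bound _ _ _ _ _ w
  (fun k => expR (- (L / N * (m%:R ^+ 2 - k%:R ^+ 2 / 2 - m%:R))))) => //.
- move=> k I J km kK Im Jm IJk.
  rewrite (_ : \sum_(G | _) w G = \sum_(G in graphs n | independent G I && independent G J)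
     \prod_(e in vpairs n) (if e \in G then d / n%:R else 1 - d / n%:R)); last first.
    by rewrite /w -big_mkcondl; apply: eq_bigl => G; rewrite andbC.
  apply: (le_trans (gnp_independent_le _ _ p01)).
  have fE : (#|forbidden_pairs I J|)%:R =
      m%:R ^+ 2 - m%:R - (k%:R ^+ 2 - k%:R) / 2 :> R.
    have := congr1 (fun x : nat => x%:R : R) (card_forbidden_pairs Im Jm IJk).
    have c2 a : 'C(a, 2)%:R = (a%:R ^+ 2 - a%:R) / 2 :> R.
      elim: a => [|a IH]; first by rewrite bin0n /= expr2; lra.
      by rewrite binS bin1 natrD IH -[a.+1]addn1 natrD; field.
    by rewrite natrD natrM !c2; lra.
  have e1 : 1 - d / n%:R <= expR (- (L / N)).
    have -> : L / N = d / n%:R by rewrite /N; field; rewrite !gt_eqF.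
    exact: expR_ge1Dx.
  apply: (@le_trans _ _ (expR (- (L / N)) ^+ #|forbidden_pairs I J|)).
    by apply: lerXn2r; rewrite ?nnegrE ?expR_ge0 // subr_ge0; case/andP: p01.
  rewrite -expRM_natr ler_expR mulNr lerN2 fE (ler_pM2l (divr_gt0 L0 N0)).
  by have : 0 <= k%:R :> R by []; lra.
move=> k km kK.
apply: (@le_trans _ _ (expR (L * (2 * m%:R - k%:R)) *
  expR (- (L / N * (m%:R ^+ 2 - k%:R ^+ 2 / 2 - m%:R))))).
  by rewrite ler_wpM2r ?expR_ge0 // shapes_le.
rewrite -expRD ler_expR.
have /andP[m1 _] := m_bounds.
have := exponent_le L0 N0 b1 bN z0 m1 (k_bounds kK); rewrite -/kappa.
have : L / N * m%:R <= 2 * L.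
  apply: (le_trans (ler_wpM2l (ltW (divr_gt0 L0 N0)) m_le)).
  have NN := lt0r_neq0 N0.
  by rewrite mulrCA divfK.
by rewrite [_ * (_ - _ - _)]mulrBr; lra.
Qed.

Lemma regular_overlap_le (e : nat) : d = e%:R ->
  (512 * expR 1 + 320) * L <= kappa * d -> 32 * L <= d -> 8 * d <= n%:R ->
  d * (d + 1) <= kappa / 4 * L * N ->
  regular_prob R e (@overlap_event R n d beta z) <=
  (2 * N + 1) * ((4 * L * N + 1) * (2 * expR 1 * expR (2 * L + 2 - kappa / 2 * L * N))).
Proof.
move=> de kd d32 n8 dd.
have E0 := expR_gt0 (1 : R).
have hk1 : 512 * expR 1 * L <= kappa * d.
  by apply: le_trans kd; rewrite ler_pM2r //; lra.
have hk2 : 320 * L <= kappa * d.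
  apply: le_trans kd; rewrite ler_pM2r //; have := E0; lra.
have k12 : kappa <= 1 / 2.
  have : beta ^+ 2 <= 1 by rewrite -(expr1n _ 2) ler_sqr ?nnegrE; have := z0; have := zb; have := b1; lra.
  by rewrite /kappa; have := sqr_ge0 z; lra.
pose w (G : {set {set 'I_n}}) : R :=
  if G \in regular_graphs n e then (#|regular_graphs n e|%:R)^-1 else 0.
have w0 G : 0 <= w G by rewrite /w; case: ifP.
have -> : regular_prob R e (@overlap_event R n d beta z) =
    \sum_(G | overlap_event d beta z G) w G.
  rewrite /regular_prob /w -big_mkcondr mulr_natl -sumr_const.
  by apply: eq_bigl => G; rewrite inE andbC.
have LN0 : 0 < L * N by rewrite mulr_gt0.
have LN4 : 4 * L * N + 1 >= 1 by have := LN0; lra.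
pose X := expR (2 * L + 2 - kappa / 2 * L * N).
have X0 : 0 < X := expR_gt0 _.
have B0 : 0 <= (4 * L * N + 1) * (2 * expR 1 * X).
  by rewrite mulr_ge0 ?(le_trans ler01 LN4) // mulr_ge0 ?(ltW X0) // mulr_ge0 ?(ltW E0).
apply: (@le_trans _ _ (m.+1%:R * ((4 * L * N + 1) * (2 * expR 1 * X)))); last first.
  by apply: ler_wpM2r => //; rewrite -natr1 lerD2r m_le.
(* Small enough that 2 t <= kappa N d / 32 fits [switch_margin], large enough that t + 1 > 5 L N. *)
pose t := Num.truncn (kappa * N * d / 64).
(* Kept below mu by kappa / 2 L N, as [switch_margin] requires; this gives up half of the rate. *)
pose j k := Num.truncn (L / N * (m%:R ^+ 2 - k%:R ^+ 2 / 2) - kappa / 2 * L * N).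
have kN0 : 0 <= kappa * N * d / 64.
  by rewrite divr_ge0 // (mulr_ge0 (mulr_ge0 (ltW kappa0) (ltW N0)) (ltW d0)).
have /andP[t1 t2] := truncn_itv kN0.
have /andP[m1 m2] := m_bounds.
have mN : N <= m%:R by move: bN m1; lra.
have jP k : (k <= m)%N ->
    (j k)%:R <= L / N * (m%:R ^+ 2 - k%:R ^+ 2 / 2) - kappa / 2 * L * N < (j k).+1%:R.
  (* The floor needs a nonnegative argument: k <= m and m >= N make the main term at least L N / 2,
     and kappa <= 1/2 makes the other at most L N / 4. *)
  move=> km; apply: truncn_itv.
  have h1 : (k%:R : R) ^+ 2 <= m%:R ^+ 2 by rewrite ler_sqr ?nnegrE // ler_nat.
  have h2 : N ^+ 2 <= m%:R ^+ 2 by rewrite ler_sqr ?nnegrE // ltW.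
  have h3 : L / N * (N ^+ 2 / 2) <= L / N * (m%:R ^+ 2 - k%:R ^+ 2 / 2).
    by rewrite ler_pM2l ?(divr_gt0 L0 N0) //; lra.
  have h4 : L / N * (N ^+ 2 / 2) = L * N / 2 by field; rewrite lt0r_neq0.
  have h5 := ler_wpM2r (ltW LN0) k12.
  by move: h3 h5; rewrite h4; lra.
have jle k : (k <= m)%N -> (j k)%:R <= 4 * L * N.
  move=> km; have /andP[h _] := jP _ km; apply: (le_trans h).
  have h1 : (m%:R : R) ^+ 2 <= (2 * N) ^+ 2.
    by rewrite ler_sqr ?nnegrE ?m_le // mulr_ge0 // ltW.
  have h2 : L / N * (m%:R ^+ 2 - k%:R ^+ 2 / 2) <= L / N * (2 * N) ^+ 2.
    by rewrite ler_pM2l ?(divr_gt0 L0 N0) //; have := sqr_ge0 (k%:R : R); lra.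
  have h3 : L / N * (2 * N) ^+ 2 = 4 * L * N by field; rewrite lt0r_neq0.
  have h4 := ler_wpM2r (ltW LN0) (ltW kappa0).
  by move: h2 h4; rewrite h3 mul0r; lra.
have nE : n%:R = N * d / L by rewrite /N; field; rewrite !lt0r_neq0.
apply: (@overlap_union_bound _ _ _ _ _ w
  (fun k => expR (- t%:R) + expR 1 * (j k).+1%:R * expR (- (j k)%:R))) => //.
- move=> k I J km kK Im Jm IJk.
  have b0 : 0 <= expR (- t%:R) + expR 1 * (j k).+1%:R * expR (- (j k)%:R) :> R.
    by rewrite addr_ge0 ?mulr_ge0 ?expR_ge0.
  have e0 : (0 < e)%N by rewrite -(ltr_nat R) -de.
  have nd0 : (0 < n * e)%N by rewrite muln_gt0 e0 andbT -(ltr_nat R).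
  have md0 : (0 < m * e)%N by rewrite muln_gt0 e0 andbT -(ltr_nat R) (lt_le_trans N0).
  have m02 : (0 : R) <= m%:R <= 2 * N by apply/andP; split; [exact: ler0n | exact: m_le].
  have /andP[j1 _] := jP k km.
  have hj : (2 * (n * e) * j k + n * e * (2 * (e.+1 * e)) + (k * e) ^ 2 <=
      2 * (m * e - 2 * j k - 2 * t) ^ 2)%N.
    have t0' : 0 <= 2 * t%:R :> R by rewrite mulr_ge0.
    have t1' : 2 * t%:R <= kappa * N * d / 32 by move: t1; lra.
    have kd' : 256 * L <= kappa * d by apply: le_trans hk2; rewrite ler_pM2r //; lra.
    have := switch_margin L0 N0 d0 nE m02 (ler0n _ (j k)) t0' kd' t1' dd j1.
    rewrite -(ler_nat R) => /le_trans h.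
    rewrite !(natrD, natrM, natrX) -[e.+1%:R]natr1 -de; apply: h.
    (* Truncated subtraction dominates real subtraction; the squares compare because the real
       difference is nonnegative. *)
    have pos : 0 <= m%:R * d - 2 * (j k)%:R - 2 * t%:R :> R.
      have g1 := ler_wpM2r (ltW d0) mN.
      have g2 := ler_wpM2r (ltW N0) kd'.
      have g3 := ler_wpM2r (ltW (mulr_gt0 N0 d0)) k12.
      by move: g1 g2 g3 (jle _ km) t1'; lra.
    rewrite ler_pM2l // ler_sqr ?nnegrE //.
    apply: le_trans (natr_subn_ge _ _ _); rewrite natrM lerD2r.
    by apply: le_trans (natr_subn_ge _ _ _); rewrite !natrM -de.
  have ht : expR 1 * ((m * e) ^ 2)%:R <=
      (t.+1 * (n * e - 4 * (m * e) - 2 * (e * e)))%:R :> R.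
    have := cross_margin L0 N0 d0 E0 nE m02 d32 n8 hk1 (ltW t2).
    rewrite natrX !natrM -de => /le_trans; apply; rewrite ler_wpM2l //.
    apply: le_trans (natr_subn_ge _ _ _); rewrite !natrM -de lerD2r.
    by apply: le_trans (natr_subn_ge _ _ _); rewrite !natrM -de.
  have := regular_independent_le Im Jm IJk nd0 md0 hj ht.
  have -> : \sum_(G | independent G I && independent G J) w G =
     (#|finset (fun G => (G \in regular_graphs n e) &&
     (independent G I && independent G J))|)%:R * (#|regular_graphs n e|%:R)^-1.
    rewrite /w -big_mkcondr mulr_natl; move: (#|regular_graphs n e|%:R^-1) => c.
    by rewrite -sumr_const; apply: eq_bigl => G; rewrite inE andbC.
  (* If there is no regular graph, the inverse is 0 and the sum vanishes. *)
  have [->|r0] := posnP #|regular_graphs n e|; first by rewrite invr0 mulr0.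
  by rewrite ler_pdivrMr ?ltr0n // mulrC.
move=> k km kK; rewrite mulrDr.
have sh := shapes_le km kK.
have mk : L * (2 * m%:R - k%:R) <= 4 * L * N.
  have : 0 <= L * k%:R by rewrite mulr_ge0 // ltW.
  have := ler_wpM2l (ltW L0) m_le; lra.
have first_term : #|pair_shapes n m k|%:R * expR (- t%:R) <= X.
  apply: (le_trans (ler_wpM2r (expR_ge0 _) sh)); rewrite -expRD ler_expR.
  (* There are at most exp(4 L N) pairs, so a tail of exponent 5 L N - 1 leaves exp(1 - L N). *)
  have : 5 * (L * N) <= kappa * N * d / 64.
    by have := ler_wpM2r (ltW N0) hk2; lra.
  have := ler_wpM2r (ltW LN0) k12.
  by move: t2 mk (ltW L0); rewrite -[t.+1%:R]natr1; lra.
have second_term : #|pair_shapes n m k|%:R * expR (- (j k)%:R) <= X.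
  apply: (le_trans (ler_wpM2r (expR_ge0 _) sh)); rewrite -expRD ler_expR.
  have := exponent_le L0 N0 b1 bN z0 m1 (k_bounds kK); rewrite -/kappa.
  by have /andP[_] := jP _ km; rewrite -[(j k).+1%:R]natr1; lra.
have E1 : 1 <= expR 1 :> R by rewrite ltW // expR_gt1.
apply: (@le_trans _ _ (X + expR 1 * (4 * L * N + 1) * X)).
  apply: lerD => //; rewrite mulrCA ler_pM ?mulr_ge0 ?expR_ge0 //.
  by rewrite ler_wpM2l ?expR_ge0 // -[(j k).+1%:R]natr1 lerD2r jle.
have := ler_pM _ _ E1 LN4; rewrite !mulr1 => /(_ ler01 ler01) h.
have := ler_wpM2r (ltW X0) h; lra.
Qed.

End Bounds.

(* The fourth bound makes cross_margin applicable (512 e) and gives kappa N d / 64 >= 5 L N (320),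
   so that the cross-edge tail exp(-t) beats the at most exp(4 L N) pairs. *)
Definition large_degree (R : realType) (beta z d : R) : Prop :=
  [/\ 1 < d, expR 1 <= (1 - z) * ln d, 2 * expR 1 <= (beta - z) * ln d,
    (512 * expR 1 + 320) * ln d <= (2 * beta ^+ 2 - 1 - z ^+ 2) / 2 * d &
    32 * ln d <= d].

(** * Choice of d and passage to the limit in n *)

Lemma near_large_degree (R : realType) (beta z : R) :
  z < 1 -> z < beta -> 0 < 2 * beta ^+ 2 - 1 - z ^+ 2 ->
  \forall d \near +oo, large_degree beta z d.
Proof.
move=> z1 zb kappa0; have E0 := expR_gt0 (1 : R).
pose kappa := (2 * beta ^+ 2 - 1 - z ^+ 2) / 2.
have k0 : 0 < kappa by rewrite divr_gt0.
have ln_ge M : \forall d \near +oo, M <= ln (d : R).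
  near=> d; have h : expR M <= d by near: d; apply: nbhs_pinfty_ge; exact: num_real.
  by rewrite -ler_expR lnK // posrE (lt_le_trans _ h) // expR_gt0.
have zb' : 0 < beta - z by rewrite subr_gt0.
have z1' : 0 < 1 - z by rewrite subr_gt0.
have C0 : 0 < 512 * expR 1 + 320 :> R by rewrite addr_gt0 ?mulr_gt0 ?ltr0n.
have C0' : 0 < 32 :> R by rewrite ltr0n.
rewrite /large_degree -/kappa.
move: (512 * expR 1 + 320 : R) (32 : R) C0 C0' => C C' C0 C0'.
near=> d; split.
- by near: d; apply: nbhs_pinfty_gt; exact: num_real.
- by rewrite -ler_pdivrMl //; near: d; exact: ln_ge.
- by rewrite -ler_pdivrMl //; near: d; exact: ln_ge.
- rewrite -ler_pdivrMl // mulrA; near: d; apply: near_mul_ln_le.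
  by rewrite mulr_gt0 ?invr_gt0.
- by near: d; exact: near_mul_ln_le.
Unshelve. all: by end_near. Qed.

Theorem theorem2p6 (R : realType) (beta z : R)
    (hbeta : 1 / Num.sqrt 2 < beta < 1)
    (hz : 0 < z < Num.sqrt (2 * beta ^+ 2 - 1)) :
  (\forall d \near +oo,
     gnp_prob (d / n%:R) (@overlap_event R n d beta z) @[n --> \oo] --> (0 : R))
  /\
  (\forall d \near \oo,
     regular_prob R d (@overlap_event R n d%:R beta z)
       @[n --> within [set n : nat | ~~ odd (n * d)] \oo] --> (0 : R)).
Proof.
case/andP: hbeta => hb b1; case/andP: hz => z0 hz.
have beta0 : 0 < beta by apply: le_lt_trans hb; rewrite divr_ge0 ?sqrtr_ge0.
have b2 : 0 < 2 * beta ^+ 2 - 1.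
  have : (1 / Num.sqrt 2) ^+ 2 < beta ^+ 2 :> R.
    by rewrite ltr_sqr ?nnegrE ?divr_ge0 ?sqrtr_ge0 // ltW.
  by rewrite expr_div_n expr1n sqr_sqrtr //; lra.
have z2 : z ^+ 2 < 2 * beta ^+ 2 - 1.
  by rewrite -[ltRHS](sqr_sqrtr (ltW b2)) ltr_sqr ?nnegrE ?sqrtr_ge0 // ltW.
have bb : beta ^+ 2 < 1 by rewrite expr_lt1 // ltW.
(* z^2 < 2 beta^2 - 1 < beta^2, because beta^2 < 1. *)
have zb : z < beta by rewrite -ltr_sqr ?nnegrE ?(ltW z0) ?(ltW beta0) //; lra.
have z1 : z < 1 by exact: lt_trans b1.
have k0 : 0 < 2 * beta ^+ 2 - 1 - z ^+ 2 by rewrite subr_gt0.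
have kappa0 : 0 < (2 * beta ^+ 2 - 1 - z ^+ 2) / 2 by rewrite divr_gt0.
have [kappa kE] : exists k, k = (2 * beta ^+ 2 - 1 - z ^+ 2) / 2.
  by exists ((2 * beta ^+ 2 - 1 - z ^+ 2) / 2).
rewrite -kE in kappa0.
have zb' : 0 < beta - z by rewrite subr_gt0.
have near_ge (c M : R) : 0 < c -> \forall n \near \oo, M <= c * (n%:R : R).
  move=> c0; near=> n; rewrite mulrC -ler_pdivrMr //; near: n; exact: nbhs_infty_ger.
split.
  near=> d.
  have [d1 Lz Lb _ _] : large_degree beta z d by near: d; exact: near_large_degree.
  have d0 : 0 < d by apply: lt_trans d1.
  have L0 : 0 < ln d by exact: ln_gt0.
  have c0 : 0 < ln d / d by rewrite divr_gt0.
  (* For fixed d, N = (ln d / d) n, so kappa L N is linear in n with this positive slope. *)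
  have c1 := mulr_gt0 (mulr_gt0 kappa0 L0) c0.
  have K0 := expR_ge0 (4 * ln d).
  have c2 : 0 <= 2 * (ln d / d) by rewrite mulr_ge0 // ltW.
  (* Only the factor 2 N + 1 is present here, so the second linear factor is taken with slope 0. *)
  apply: squeeze_cvgr (cvg_cst 0) (cvg_poly_expR c2 (lexx 0) K0 c1).
  near=> n.
  have dn : d <= n%:R by near: n; exact: nbhs_infty_ger.
  have Nb : 2 <= (beta - z) * (n%:R * ln d / d).
    rewrite -[_ * ln d / d]mulrA [n%:R * _]mulrC mulrA; near: n; apply: near_ge.
    by rewrite mulr_gt0.
  apply/andP; split.
    apply: sumr_ge0 => G _; apply: prodr_ge0 => e _; case: ifP => _.
      by rewrite divr_ge0 // ltW.
    by rewrite subr_ge0 ler_pdivrMr ?mul1r // (lt_le_trans d0).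
  apply: (le_trans (gnp_overlap_le z0 b1 d1 Lz Lb dn Nb)).
  rewrite mul0r add0r mulr1 -expRD -kE.
  rewrite le_eqVlt; apply/orP; left; apply/eqP; congr (_ * expR _).
    by ring.
  by ring.
(* A real threshold A is extracted, so that all integer degrees above it qualify. *)
have [A [_ HA]] := near_large_degree z1 zb k0.
near=> e.
have Ae : A < e%:R.
  by apply: (@lt_le_trans _ _ (A + 1)); [rewrite ltrDl | near: e; exact: nbhs_infty_ger].
have [d1 Lz Lb kd d32] := HA _ Ae; set d : R := e%:R in d1 Lz Lb kd d32 *.
have d0 : 0 < d by apply: lt_trans d1.
have L0 : 0 < ln d by exact: ln_gt0.
have c0 : 0 < ln d / d by rewrite divr_gt0.
have k2 : 0 < kappa / 2 by rewrite divr_gt0.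
have k4 : 0 < kappa / 4 by rewrite divr_gt0.
have c1 := mulr_gt0 (mulr_gt0 k2 L0) c0.
have K0 : 0 <= 2 * expR 1 * expR (2 * ln d + 2) by rewrite !mulr_ge0 ?expR_ge0.
have c2 : 0 <= 2 * (ln d / d) by rewrite mulr_ge0 // ltW.
have c3 : 0 <= 4 * ln d * (ln d / d) by exact: mulr_ge0 (mulr_ge0 (ler0n _ 4) (ltW L0)) (ltW c0).
(* [regular_prob] is 0 when there is no regular graph, so the bound holds for all large n and the
   limit can be taken without the parity restriction. *)
apply: cvg_within_filter.
apply: squeeze_cvgr (cvg_cst 0) (cvg_poly_expR c2 c3 K0 c1).
near=> n; apply/andP; split; first by rewrite divr_ge0.
have dn : d <= n%:R by near: n; exact: nbhs_infty_ger.
have n8 : 8 * d <= n%:R by near: n; exact: nbhs_infty_ger.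
have NE : n%:R * ln d / d = ln d / d * n%:R by rewrite -mulrA mulrC.
have Nb : 2 <= (beta - z) * (n%:R * ln d / d).
  by rewrite NE mulrA; near: n; apply: near_ge; rewrite mulr_gt0.
have dd : d * (d + 1) <= kappa / 4 * ln d * (n%:R * ln d / d).
  by rewrite NE mulrA; near: n; apply: near_ge; exact: mulr_gt0 (mulr_gt0 k4 L0) c0.
rewrite kE in kappa0 dd.
apply: (le_trans (regular_overlap_le z0 zb b1 kappa0 d1 Lz Lb dn Nb erefl kd d32 n8 dd)).
rewrite NE -kE.
have -> : 2 * ln d + 2 - kappa / 2 * ln d * (ln d / d * n%:R) =
   (2 * ln d + 2) + - (kappa / 2 * ln d * (ln d / d) * n%:R) by ring.
by rewrite [expR (_ + - _)]expRD le_eqVlt; apply/orP; left; apply/eqP; ring.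
Unshelve. all: by end_near. Qed.
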